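(* Let $P\in\mathcal{P}_2(\mathcal{P}_2(\mathbb{R}^D))$ be a probability measure on the $2$-Wasserstein space and let $\mu^\star\in\mathcal{P}_2(\mathbb{R}^D)$ be a barycenter of $P$, with $\sigma^2$ the variance of $P$. Let $\alpha,\beta>0$ and suppose that every $\mu\in\mathrm{supp}(P)$ is the pushforward of $\mu^\star$ by the gradient of an $\alpha$-strongly convex and $\beta$-smooth function $\varphi_{\mu^\star\to\mu}:\mathbb{R}^D\to\mathbb{R}$, i.e. $\mu=(\nabla\varphi_{\mu^\star\to\mu})_{\#}\mu^\star$. Then, if $\beta-\alpha<1$, $\mu^\star$ is the unique barycenter of $P$ and, for any $n\ge1$, any empirical barycenter $\mu_n$ of $P$ satisfies \[ \mathbb{E}\,W_2^2(\mu_n,\mu^\star)\le\frac{4\sigma^2}{(1-\beta+\alpha)^2 n}. \]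
   Context: $\mathcal{P}_2(\mathbb{R}^D)$ is the set of Borel probability measures on $\mathbb{R}^D$ with finite second moment, equipped with the $2$-Wasserstein distance $W_2$ (for the cost $|x-y|^2$). $\mathcal{P}_2(\mathcal{P}_2(\mathbb{R}^D))$ is the set of Borel probability measures $P$ on $(\mathcal{P}_2(\mathbb{R}^D),W_2)$ with $\int W_2^2(\nu,\mu)\,\mathrm{d}P(\mu)<\infty$ for all $\nu$. A barycenter of $P$ is any minimizer $\mu^\star$ over $\nu\in\mathcal{P}_2(\mathbb{R}^D)$ of $\nu\mapsto\int W_2^2(\nu,\mu)\,\mathrm{d}P(\mu)$ (existence is implicitly assumed), and the variance is $\sigma^2=\int W_2^2(\mu^\star,\mu)\,\mathrm{d}P(\mu)$. An empirical barycenter $\mu_n$ is any barycenter of $\frac1n\sum_{i=1}^n\delta_{X_i}$, where $X_1,\dots,X_n$ are i.i.d. with distribution $P$. The subdifferential of $\varphi:\mathbb{R}^D\to\mathbb{R}$ at $x$ is $\partial\varphi(x)=\{g:\varphi(y)\ge\varphi(x)+\langle g,y-x\rangle\ \forall y\}$. The function $\varphi$ is $\alpha$-strongly convex if for all $x$, $\partial\varphi(x)\neq\emptyset$ and $\langle g,x-y\rangle\ge\varphi(x)-\varphi(y)+\frac{\alpha}{2}|x-y|^2$ for all $g\in\partial\varphi(x)$ and all $y$. A convex $\varphi$ is $\beta$-smooth if $\langle g,x-y\rangle\le\varphi(x)-\varphi(y)+\frac{\beta}{2}|x-y|^2$ for all $x,y$ and all $g\in\partial\varphi(x)$; such functions are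 differentiable. *)

(* Defs.v *)
From HB Require Import structures.
From mathcomp Require Import all_boot all_order all_algebra.
From mathcomp Require Import all_classical all_reals all_analysis measurable_realfun giry.

Set Implicit Arguments.
Unset Strict Implicit.
Unset Printing Implicit Defensive.

Import Order.TTheory GRing.Theory Num.Theory.
Import numFieldNormedType.Exports.

Local Open Scope classical_set_scope.
Local Open Scope ring_scope.

(* The norm that MathComp-Analysis puts on 'rV[R]_D is the sup norm: it is used
   here only through the topology (equal to the Euclidean one). *)
Definition edot (R : realType) (D : nat) (x y : 'rV[R]_D) : R :=
  \sum_(i < D) x 0 i * y 0 i.

Definition enorm (R : realType) (D : nat) (x : 'rV[R]_D) : R :=
  Num.sqrt (edot x x).

Definition subdifferential (R : realType) (D : nat) (phi : 'rV[R]_D -> R)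
    (x : 'rV[R]_D) : set 'rV[R]_D :=
  [set g | forall y, phi x + edot g (y - x) <= phi y].

Definition strongly_convex (R : realType) (D : nat) (alpha : R)
    (phi : 'rV[R]_D -> R) : Prop :=
  forall x, subdifferential phi x !=set0 /\
    (forall g, subdifferential phi x g -> forall y,
      phi x - phi y + alpha / 2 * enorm (x - y) ^+ 2 <= edot g (x - y)).

Definition smooth (R : realType) (D : nat) (beta : R)
    (phi : 'rV[R]_D -> R) : Prop :=
  convex_function setT phi /\
  forall x y g, subdifferential phi x g ->
    edot g (x - y) <= phi x - phi y + beta / 2 * enorm (x - y) ^+ 2.

(* Partial derivatives: this is the gradient where phi is differentiable, in
   particular everywhere for a convex smooth phi. *)
Definition gradient (R : realType) (D : nat) (phi : 'rV[R]_D -> R)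
    (x : 'rV[R]_D) : 'rV[R]_D :=
  \row_(i < D) 'D_(delta_mx 0 i) phi x.

Definition euclidean (R : realType) (D : nat) :=
  g_sigma_algebraType (@open 'rV[R]_D).

(* Measures are functions on all subsets, so two elements of [P2 R D] that
   agree on every Borel set need not be Leibniz-equal: equality of the
   underlying Borel measures is [measure_eq], and [W2] is a pseudometric on
   this type that separates points exactly up to [measure_eq]. *)
Record P2 (R : realType) (D : nat) := MkP2 {
  P2_measure :> probability (euclidean R D) R ;
  P2_moment : (\int[P2_measure]_x (enorm x ^+ 2)%:E < +oo)%E }.

Definition couplings (R : realType) (D : nat) (mu nu : P2 R D) :
    set (probability (euclidean R D * euclidean R D)%type R) :=
  [set pi | forall A, measurable A ->
    pi (A `*` setT) = mu A /\ pi (setT `*` A) = nu A].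

Definition W2 (R : realType) (D : nat) (mu nu : P2 R D) : \bar R :=
  (ereal_inf [set \int[pi]_z (enorm (z.1 - z.2 : 'rV[R]_D) ^+ 2)%:E
             | pi in couplings mu nu] `^ 2^-1)%E.

Definition W2_open (R : realType) (D : nat) : set (set (P2 R D)) :=
  [set U | forall mu, U mu ->
    exists2 r : R, 0 < r & forall nu, (W2 mu nu < r%:E)%E -> U nu].

Section P2_pointed.
Variables (R : realType) (D : nat).

Let dirac0 : probability (euclidean R D) R :=
  @dirac _ (euclidean R D) (0 : 'rV[R]_D) R.

Let measurable_coord (i : 'I_D) :
  measurable_fun setT (fun x : euclidean R D => (x : 'rV[R]_D) 0 i).
Proof.
apply: (measurability _ (RGenOpens.measurableE R)).
move=> _ [_ [a [b ->] <-]]; rewrite setTI; apply: sub_sigma_algebra.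
by move/continuousP : (@coord_continuous R 1 D 0 i); apply; exact: interval_open.
Qed.

Let measurable_enorm :
  measurable_fun setT (fun x : euclidean R D => enorm x ^+ 2).
Proof.
rewrite (_ : (fun x => _) = fun x : euclidean R D =>
    \sum_(i < D) (x : 'rV[R]_D) 0 i * (x : 'rV[R]_D) 0 i).
  by apply: measurable_sum => i; exact: measurable_funM.
apply/funext => x; rewrite /enorm sqr_sqrtr // /edot.
by apply: sumr_ge0 => i _; rewrite -expr2 sqr_ge0.
Qed.

Lemma dirac0_moment : (\int[dirac0]_x (enorm x ^+ 2)%:E < +oo)%E.
Proof.
rewrite integral_dirac; first by rewrite diracT mul1e ltry.
  exact: measurableT.
by apply/measurable_EFinP; exact: measurable_enorm.
Qed.

HB.instance Definition _ := gen_eqMixin (P2 R D).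
HB.instance Definition _ := gen_choiceMixin (P2 R D).
HB.instance Definition _ := isPointed.Build (P2 R D) (MkP2 dirac0_moment).

End P2_pointed.

Definition wasserstein (R : realType) (D : nat) :=
  g_sigma_algebraType (@W2_open R D).

(* [Q] is a measure, not necessarily a probability, only so that both a
   probability and the sum of point masses [empirical] below can be used. *)
Definition barycenter_functional (R : realType) (D : nat)
    (Q : {measure set (wasserstein R D) -> \bar R}) (nu : P2 R D) : \bar R :=
  (\int[Q]_mu (W2 nu mu ^+ 2))%E.

Definition is_barycenter (R : realType) (D : nat)
    (Q : {measure set (wasserstein R D) -> \bar R}) (nu : P2 R D) : Prop :=
  forall nu' : P2 R D,
    (barycenter_functional Q nu <= barycenter_functional Q nu')%E.

Definition in_P2P2 (R : realType) (D : nat)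
    (P : probability (wasserstein R D) R) : Prop :=
  forall nu : P2 R D, (barycenter_functional P nu < +oo)%E.

(* Topological support for the W2-topology. *)
Definition supp (R : realType) (D : nat)
    (P : probability (wasserstein R D) R) : set (P2 R D) :=
  [set mu | forall U, W2_open U -> U mu -> (0 < P U)%E].

Section empirical.
Context d (T : measurableType d) (R : realType) (n : nat).
Variable x : 'I_n -> T.

(* The zero measure when n = 0. *)
Definition empirical (A : set T) : \bar R :=
  ((n%:R^-1)%:E * \sum_(i < n) \d_(x i) A)%E.

Let atom (k : nat) : {measure set T -> \bar R} :=
  if insub k is Some i then @dirac _ T (x i) R else mzero.

Let empiricalE : empirical = mscale (n%:R^-1)%:nng (msum atom n).
Proof.
apply/funext => A; rewrite /empirical /mscale /msum; congr (_ * _)%E.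
by apply: eq_bigr => i _; rewrite /atom valK.
Qed.

Let empirical0 : empirical set0 = 0%E.
Proof. by rewrite empiricalE measure0. Qed.

Let empirical_ge0 A : (0 <= empirical A)%E.
Proof. by rewrite empiricalE measure_ge0. Qed.

Let empirical_sigma_additive : semi_sigma_additive empirical.
Proof. by rewrite empiricalE; exact: measure_semi_sigma_additive. Qed.

HB.instance Definition _ := isMeasure.Build _ _ _ empirical
  empirical0 empirical_ge0 empirical_sigma_additive.

End empirical.
Arguments empirical {d T} R {n} x A.

Definition mutually_independent d (Omega : measurableType d) d'
    (T : measurableType d') (R : realType) (Pr : probability Omega R) (n : nat)
    (X : 'I_n -> {mfun Omega >-> T}) : Prop :=
  forall (J : {set 'I_n}) (A : 'I_n -> set T),
    (forall i, measurable (A i)) ->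
    Pr (\bigcap_(i in [set` J]) (X i @^-1` A i)) =
    (\prod_(i in J) Pr (X i @^-1` A i))%E.

Definition iid d (Omega : measurableType d) d'
    (T : measurableType d') (R : realType) (Pr : probability Omega R)
    (P : probability T R) (n : nat) (X : 'I_n -> {mfun Omega >-> T}) : Prop :=
  mutually_independent Pr X /\
  forall i, measure_eq (distribution Pr (X i)) P.

(* Main.v *)
Require Import Defs.
From HB Require Import structures.
From mathcomp Require Import all_boot all_order all_algebra.
From mathcomp Require Import all_classical all_reals all_analysis
  measurable_realfun giry.
From mathcomp Require Import ring lra.

Set Implicit Arguments.
Unset Strict Implicit.
Unset Printing Implicit Defensive.

Import Order.TTheory GRing.Theory Num.Theory.
Import numFieldNormedType.Exports.

Local Open Scope classical_set_scope.
Local Open Scope ring_scope.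

(* Write T_mu for the gradient pushing mustar to mu and xi_mu = id - T_mu.  If
   (X, Y) couples mustar and b, a coupling of b and mu, seen through T_mu as a
   coupling of b and mustar, and the quadratic bounds of the potential give the
   "hugging" inequality
     W2^2(b, mu) >= |xi_mu|^2 + alpha W2^2(b, mustar)
       + (1 - beta) E|X - Y|^2 + 2 E<xi_mu(X), Y - X>,
   whence W2^2(mustar, mu) = |xi_mu|^2 in L^2(mustar).  Optimality of mustar
   along t |-> law(X + t H) gives E_P E<xi_mu(X), H> >= 0 for all H.  With
   H = Y - X this yields the variance inequality with constant
   k = 1 - beta + alpha, hence uniqueness.  For an empirical barycenter b,
   averaging the hugging inequality over the sample and completing the square
   gives k^2 W2^2(b, mustar) <= 4 |n^-1 sum_i xi_(X_i)|^2, and H = +- xi_mu'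
   shows that the xi_(X_i) are centred, so that the right-hand side has
   expectation 4 sigma^2 / n.

   The inner products E<xi_mu(X), H> are uniform limits of difference quotients
   of squared distances, hence continuous in mu on supp P: this is the source of
   all measurability in mu.  It uses the triangle inequality and the
   separability of the Wasserstein space, both obtained by gluing couplings
   along a countable partition. *)

(** * Euclidean vectors *)

(** The coupling (X, Y) in the hugging inequality is unrelated to the couplings of b with mu: the
    cost of the latter is bounded below by a term in alpha plus a function of each endpoint alone,
    and such functions integrate to the same value along every coupling with these marginals. One
    almost optimal (X, Y) therefore serves all mu at once, and the inequality can be averaged over P
    or over a sample although good couplings of b with mu vary with mu. The marginals must be b and
    mustar for this, hence the lift through the inverse of T_mu, which exists because alpha > 0.

    The variance inequality for P does not apply to the empirical measure, of which mustar need not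
    be a barycenter: the first-order term survives and is exactly the fluctuation n^-1 sum_i
    xi_(X_i). Young's inequality spends half of the quadratic term on it, whence the factor 4.

    Independence makes the mixed terms of the squared norm vanish through Fubini, which requires
    joint measurability in the pair of samples. The empirical barycenter is an arbitrary function of
    the outcome, so the left-hand expectation is a lower integral, controlled through a measurable
    majorant. *)

Section edot_theory.
Context {R : realType} {D : nat}.
Implicit Types (x y z : 'rV[R]_D) (a s : R).

Lemma edotC x y : edot x y = edot y x.
Proof. by apply: eq_bigr => i _; rewrite mulrC. Qed.

Lemma edotDl x y z : edot (x + y) z = edot x z + edot y z.
Proof. by rewrite /edot -big_split; apply: eq_bigr => i _;
  rewrite mxE mulrDl. Qed.

Lemma edotZl a x y : edot (a *: x) y = a * edot x y.
Proof. by rewrite /edot mulr_sumr; apply: eq_bigr => i _;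
  rewrite mxE mulrA. Qed.

Lemma edotNl x y : edot (- x) y = - edot x y.
Proof. by rewrite -scaleN1r edotZl mulN1r. Qed.

Lemma edotBl x y z : edot (x - y) z = edot x z - edot y z.
Proof. by rewrite edotDl edotNl. Qed.

Lemma edotDr x y z : edot x (y + z) = edot x y + edot x z.
Proof. by rewrite edotC edotDl !(edotC _ x). Qed.

Lemma edotZr a x y : edot x (a *: y) = a * edot x y.
Proof. by rewrite edotC edotZl edotC. Qed.

Lemma edotNr x y : edot x (- y) = - edot x y.
Proof. by rewrite edotC edotNl edotC. Qed.

Lemma edotBr x y z : edot x (y - z) = edot x y - edot x z.
Proof. by rewrite edotDr edotNr. Qed.

Lemma edot0l x : edot 0 x = 0.
Proof. by rewrite /edot big1// => i _; rewrite mxE mul0r. Qed.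

Definition edotE := (edotDl, edotDr, edotNl, edotNr, edotZl, edotZr).

Lemma edot_ge0 x : 0 <= edot x x.
Proof. by apply: sumr_ge0 => i _; rewrite -expr2 sqr_ge0. Qed.

Lemma edot_eq0 x : edot x x = 0 -> x = 0.
Proof.
move/eqP; rewrite psumr_eq0 => [|i _]; last by rewrite -expr2 sqr_ge0.
move/allP => x0; apply/rowP => i; rewrite mxE.
by have := x0 i (mem_index_enum _); rewrite -expr2 sqrf_eq0 => /eqP.
Qed.

Lemma edot_delta x i : edot x (delta_mx 0 i) = x 0 i.
Proof.
rewrite /edot (bigD1 i)//= big1 => [|j ji]; last first.
  by rewrite mxE eqxx (negbTE ji) mulr0.
by rewrite mxE !eqxx mulr1 addr0.
Qed.

Lemma coord_sqr_le x i : x 0 i ^+ 2 <= edot x x.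
Proof.
rewrite /edot (bigD1 i)//= expr2 lerDl.
by apply: sumr_ge0 => j _; rewrite -expr2 sqr_ge0.
Qed.

Lemma enorm_sqr x : enorm x ^+ 2 = edot x x.
Proof. by rewrite /enorm sqr_sqrtr// edot_ge0. Qed.

Lemma edot_young s x y : 0 < s ->
  2 * edot x y <= s * edot x x + s^-1 * edot y y.
Proof.
move=> s0; have := edot_ge0 (s *: x - y); rewrite !edotE (edotC y x).
move=> h; rewrite -(ler_pM2l s0) mulrDr (mulrA s s^-1) divff ?gt_eqF// mul1r.
by nra.
Qed.

Lemma edot_normD s x y : 0 < s ->
  edot (x + y) (x + y) <= (1 + s) * edot x x + (1 + s^-1) * edot y y.
Proof. by move=> s0; have := edot_young x y s0; rewrite !edotE (edotC y x);
  lra. Qed.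

(** The path from [x] to [y] is broken at [u] and [v]. The weight [1 + s] of the first leg can be
    taken close to 1, which continuity of the cost requires. *)
Lemma edot_chain s delta x u v y : 0 < s ->
  edot (u - v) (u - v) <= delta ->
  edot (x - y) (x - y) <= (1 + s) * edot (x - u) (x - u) +
    (1 + s^-1) * (2 * edot (v - y) (v - y) + 2 * delta).
Proof.
move=> s0 uv; have -> : x - y = (x - u) + (u - y) by rewrite addrA subrK.
apply: (le_trans (edot_normD _ _ s0)); rewrite lerD2l ler_wpM2l//.
  by rewrite addr_ge0// invr_ge0 ltW.
have -> : u - y = (v - y) + (u - v) by rewrite [RHS]addrC addrA subrK.
apply: (le_trans (edot_normD _ _ (@ltr01 R))); rewrite invr1.
by move: (edot (u - v) _) uv => p ?; lra.
Qed.

Lemma edot_suml I (r : seq I) (F : I -> 'rV[R]_D) x :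
  edot (\sum_(i <- r) F i) x = \sum_(i <- r) edot (F i) x.
Proof.
elim: r => [|i r ih]; first by rewrite !big_nil edot0l.
by rewrite !big_cons edotDl ih.
Qed.

Lemma edot_sumr I (r : seq I) (F : I -> 'rV[R]_D) x :
  edot x (\sum_(i <- r) F i) = \sum_(i <- r) edot x (F i).
Proof. by rewrite edotC edot_suml; apply: eq_bigr => i _; rewrite edotC. Qed.

Lemma edot_normB2 x y : edot (x - y) (x - y) <= 2 * edot x x + 2 * edot y y.
Proof.
have := edot_normD x (- y) (@ltr01 R); rewrite invr1 => /le_trans; apply.
by rewrite !edotE; lra.
Qed.

Lemma edot_le_half x y : `|edot x y| <= edot x x + edot y y.
Proof.
have := edot_ge0 (x + y); have := edot_ge0 (x - y).
have := edot_ge0 x; have := edot_ge0 y.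
by rewrite !edotE (edotC y x) ler_norml => *; apply/andP; split; lra.
Qed.

Lemma edot_small x e : (forall i, `|x 0 i| <= e) -> edot x x <= D%:R * e ^+ 2.
Proof.
move=> xe; apply: (@le_trans _ _ (\sum_(i < D) e ^+ 2)).
  apply: ler_sum => i _; rewrite -expr2 -[leLHS]real_normK ?num_real//.
  by rewrite lerXn2r// ?nnegrE// (le_trans _ (xe i)).
by rewrite sumr_const card_ord mulr_natl.
Qed.

Lemma ball_rowP x y e : 0 < e -> (forall i, `|x 0 i - y 0 i| < e) -> ball x e y.
Proof. by move=> e0 h; split=> // i j; rewrite !ord1; exact: h. Qed.

Lemma edot_lt_ball x y e : 0 < e -> edot (x - y) (x - y) < e ^+ 2 -> ball x e y.
Proof.
move=> e0 xy; apply: ball_rowP => // i.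
rewrite -(@ltr_pXn2r _ 2)// ?nnegrE// ?ltW// real_normK ?num_real//.
by apply: le_lt_trans xy; have := coord_sqr_le (x - y) i; rewrite !mxE.
Qed.

Lemma ball_edot_lt r : 0 < r -> exists2 e, 0 < e &
  forall x y, ball x e y -> edot (x - y) (x - y) < r.
Proof.
(* [D.+1] in place of [D] keeps the radius positive in dimension 0 and makes the final inequality
   strict. *)
move=> r0; exists (Num.sqrt (r / D.+1%:R)); first by rewrite sqrtr_gt0 divr_gt0.
move=> x y [_ xy]; apply: (@le_lt_trans _ _ (D%:R * Num.sqrt (r / D.+1%:R) ^+
  2)).
  by apply: edot_small => i; rewrite !mxE; exact/ltW/xy.
rewrite sqr_sqrtr; last by rewrite divr_ge0// ltW.
by rewrite mulrCA -[ltRHS]mulr1 ltr_pM2l// ltr_pdivrMr// mul1r ltr_nat.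
Qed.

End edot_theory.

(** * Borel measurability of vector-valued maps *)

Section euclidean_measurability.
Context {R : realType} {D : nat}.

Lemma measurable_coord (i : 'I_D) :
  measurable_fun setT (fun x : euclidean R D => (x : 'rV[R]_D) 0 i).
Proof.
apply: (measurability _ (RGenOpens.measurableE R)).
move=> _ [_ [a [b ->] <-]]; rewrite setTI; apply: sub_sigma_algebra.
by move/continuousP : (@coord_continuous R 1 D 0 i); apply;
  exact: interval_open.
Qed.

Lemma open_measurable_euclidean (U : set 'rV[R]_D) : open U ->
  measurable (U : set (euclidean R D)).
Proof. exact: sub_sigma_algebra. Qed.

Lemma closed_measurable_euclidean (F : set 'rV[R]_D) : closed F ->
  measurable (F : set (euclidean R D)).
Proof.
move=> cF; rewrite -[F]setCK; apply: measurableC.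
by apply: open_measurable_euclidean; rewrite openC.
Qed.

Lemma continuous_measurable_euclidean (f : 'rV[R]_D -> R) : continuous f ->
  measurable_fun setT (f : euclidean R D -> R).
Proof.
move=> cf; apply: (measurability _ (RGenOpens.measurableE R)).
move=> _ [_ [a [b ->] <-]]; rewrite setTI; apply: open_measurable_euclidean.
by move/continuousP : cf; apply; exact: interval_open.
Qed.

(** An open set is a countable union of cubes with rational centre and half-side [n.+1%:R^-1], and
    the preimage of a cube is a finite intersection of preimages of intervals under the coordinates.
    This links the sigma-algebra generated by open sets to coordinatewise computations. *)
Lemma measurable_fun_euclidean d (T : measurableType d) (f : T -> euclidean R D)
  :
  (forall i, measurable_fun setT (fun w => (f w : 'rV[R]_D) 0 i)) ->
  measurable_fun setT f.
Proof.
move=> mf.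
pose G : set (set (euclidean R D)) := @open 'rV[R]_D.
have mE : measurable = <<s G >> by [].
apply: (measurability G mE) => _ [U oU <-]; rewrite setTI.
pose q (c : 'rV[rat]_D) : 'rV[R]_D := \row_i ratr (c 0 i).
pose B (c : 'rV[rat]_D) (n : nat) :=
  [set x : 'rV[R]_D | forall i, `|q c 0 i - x 0 i| < n.+1%:R^-1].
(* Cubes are enumerated through their codes; a number that codes no cube, or a cube that is not
   inside [U], contributes the empty set. *)
pose V (k : nat) : set T :=
  if unpickle k is Some (c, n) then
    if asbool (B c n `<=` U) then f @^-1` B c n else set0 else set0.
have -> : f @^-1` U = \bigcup_k V k.
  apply/seteqP; split => [w fwU|w [k _]]; last first.
    by rewrite /V; case: unpickle => // -[c n]; case: asboolP => // + ?; exact.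
  have /nbhs_ballP[e /= e0 eU] := open_nbhs_nbhs (conj oU fwU).
  have [n ne] : exists n : nat, n.+1%:R^-1 < e / 2.
    have [n _ h] := near_infty_natSinv_lt (PosNum (divr_gt0 e0 (@ltr0n R 2))).
    by exists n; exact: (h n (leqnn n)).
  have [c wc] : exists c : 'rV[rat]_D, forall i,
      `|q c 0 i - (f w : 'rV[R]_D) 0 i| < n.+1%:R^-1.
    have /fin_all_exists[c hc] : forall i, exists r : rat,
        `|ratr r - (f w : 'rV[R]_D) 0 i| < n.+1%:R^-1.
      move=> i; set a := (f w : 'rV[R]_D) 0 i.
      have [] := @rat_in_itvoo R (a - n.+1%:R^-1) (a + n.+1%:R^-1).
        by rewrite ltrBlDr -addrA ltrDl addr_gt0 ?invr_gt0.
      move=> r /itvP r12; exists r.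
      by rewrite ltr_norml ltrBlDr ltrBrDr addrC [X in _ && (_ < X)]addrC !r12.
    by exists (\row_i c i) => i; rewrite !mxE.
  exists (pickle (c, n)) => //; rewrite /V pickleK.
  case: asboolP => [_ //|]; case=> x Bx; apply: eU; apply: ball_rowP => // i.
  have := wc i; have := Bx i.
  set u := q c 0 i; set v := x 0 i; set a := (f w : 'rV[R]_D) 0 i => h1 h2.
  rewrite (_ : a - v = (u - v) - (u - a)); last lra.
  apply: (le_lt_trans (ler_normB _ _)).
  move: h1 h2 ne; move: `|u - v| `|u - a| => p1 p2; set e1 := (_.+1)%:R^-1.
  lra.
apply: bigcupT_measurable => k; rewrite /V; case: unpickle => // -[c n].
case: asboolP => // _.
rewrite (_ : f @^-1` B c n = \bigcap_(i in [set: 'I_D])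
   (fun w => q c 0 i - (f w : 'rV[R]_D) 0 i) @^-1`
     [set y | `|y| < n.+1%:R^-1]); last first.
  apply/seteqP; split => w /= h; first by move=> i _; exact: h.
  by move=> i; exact: h.
apply: fin_bigcap_measurable => // i _; rewrite -[X in measurable X]setTI.
apply: (measurable_funB (measurable_cst _) (mf i)) => //.
have -> : [set y : R | `|y| < n.+1%:R^-1] = `]- n.+1%:R^-1, n.+1%:R^-1[%classic.
  by apply/seteqP; split => y /=; rewrite in_itv/= ltr_norml.
exact: measurable_itv.
Qed.

Lemma continuous_measurable_map (G : 'rV[R]_D -> 'rV[R]_D) : continuous G ->
  measurable_fun setT (G : euclidean R D -> euclidean R D).
Proof.
move=> cG; apply: measurable_fun_euclidean => i.
apply: (@continuous_measurable_euclidean (fun x => G x 0 i)) => x.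
exact: (@continuous_comp _ _ _ G (fun M : 'rV[R]_D => M 0 i) x (cG x)
  (@coord_continuous R 1 D 0 i (G x))).
Qed.

Context d (T : measurableType d).
Implicit Types f g : T -> euclidean R D.

Lemma measurable_fun_coord f i : measurable_fun setT f ->
  measurable_fun setT (fun w => (f w : 'rV[R]_D) 0 i).
Proof. by move=> mf; apply: (measurableT_comp (measurable_coord i)). Qed.

Lemma measurable_funD_euclidean f g :
  measurable_fun setT f -> measurable_fun setT g ->
  measurable_fun setT (fun w => (f w : 'rV[R]_D) + g w : euclidean R D).
Proof.
move=> mf mg; apply: measurable_fun_euclidean => i.
under eq_fun do rewrite mxE.
by apply: measurable_funD; exact: measurable_fun_coord.
Qed.

Lemma measurable_funZ_euclidean (k : R) f : measurable_fun setT f ->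
  measurable_fun setT (fun w => k *: (f w : 'rV[R]_D) : euclidean R D).
Proof.
move=> mf; apply: measurable_fun_euclidean => i.
under eq_fun do rewrite mxE.
by apply: measurable_funM => //; exact: measurable_fun_coord.
Qed.

Lemma measurable_funB_euclidean f g :
  measurable_fun setT f -> measurable_fun setT g ->
  measurable_fun setT (fun w => (f w : 'rV[R]_D) - g w : euclidean R D).
Proof.
move=> mf mg; under eq_fun do rewrite -scaleN1r.
by apply: measurable_funD_euclidean => //; exact: measurable_funZ_euclidean.
Qed.

Lemma measurable_edot f g : measurable_fun setT f -> measurable_fun setT g ->
  measurable_fun setT (fun w => edot (f w) (g w)).
Proof.
move=> mf mg; apply: measurable_sum => i.
by apply: measurable_funM; exact: measurable_fun_coord.
Qed.

End euclidean_measurability.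

(** * Random vectors and the transport cost *)

Section L2_theory.
Context d {T : measurableType d} {R : realType} (Q : probability T R).

Lemma integrable_dominated (f g : T -> R) : measurable_fun setT f ->
  Q.-integrable setT (fun w => (g w)%:E) -> (forall w, `|f w| <= g w) ->
  Q.-integrable setT (fun w => (f w)%:E).
Proof.
move=> mf ig fg; apply: (le_integrable _ _ _ ig) => //.
  exact/measurable_EFinP.
by move=> w _ /=; rewrite lee_fin (le_trans (fg w))// ler_norm.
Qed.

Lemma integrable_EFinD (f g : T -> R) :
  Q.-integrable setT (fun w => (f w)%:E) ->
  Q.-integrable setT (fun w => (g w)%:E) ->
  Q.-integrable setT (fun w => (f w + g w)%:E).
Proof. by move=> f1 g1; have := integrableD measurableT f1 g1. Qed.

Lemma integrable_EFinZ (k : R) (f : T -> R) :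
  Q.-integrable setT (fun w => (f w)%:E) ->
  Q.-integrable setT (fun w => (k * f w)%:E).
Proof. by move=> f1; have := integrableZl measurableT k f1. Qed.

Lemma integrable_EFin_cst (k : R) : Q.-integrable setT (fun=> k%:E).
Proof. exact: finite_measure_integrable_cst. Qed.

Lemma ge0_integrable_EFin (f : T -> R) : measurable_fun setT f ->
  (forall w, 0 <= f w) -> (\int[Q]_w (f w)%:E < +oo)%E ->
  Q.-integrable setT (fun w => (f w)%:E).
Proof.
move=> mf f0 foo; apply/integrableP; split; first exact/measurable_EFinP.
by under eq_integral do rewrite /= ger0_norm//.
Qed.

Lemma Rintegral_probability_cst (k : R) : \int[Q]_w k = k.
Proof.
rewrite Rintegral_cst//; transitivity (k * fine (1%E : \bar R));
  last by rewrite mulr1.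
by congr (k * fine _); exact: probability_setT.
Qed.

Lemma EFin_Rintegral (f : T -> R) : Q.-integrable setT (fun w => (f w)%:E) ->
  (\int[Q]_w f w)%:E = (\int[Q]_w (f w)%:E)%E.
Proof. by move=> fi; rewrite /Rintegral fineK//; exact: integrable_fin_num. Qed.

Lemma integrable_EFin_sum I (r : seq I) (F : I -> T -> R) :
  (forall i, Q.-integrable setT (fun w => (F i w)%:E)) ->
  Q.-integrable setT (fun w => (\sum_(i <- r) F i w)%:E).
Proof.
move=> Fi; elim: r => [|i r ih].
  by under eq_fun do rewrite big_nil; exact: integrable_EFin_cst.
by under eq_fun do rewrite big_cons; exact: integrable_EFinD.
Qed.

Lemma Rintegral_sum I (r : seq I) (F : I -> T -> R) :
  (forall i, Q.-integrable setT (fun w => (F i w)%:E)) ->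
  \int[Q]_w (\sum_(i <- r) F i w) = \sum_(i <- r) \int[Q]_w F i w.
Proof.
move=> Fi; elim: r => [|i r ih].
  rewrite big_nil; under eq_Rintegral do rewrite big_nil.
  by rewrite Rintegral_probability_cst.
rewrite big_cons -ih -RintegralD//; [|exact: Fi|exact: integrable_EFin_sum].
by apply: eq_Rintegral => w _; rewrite big_cons.
Qed.

Lemma Rintegral_indic (A : set T) : measurable A ->
  \int[Q]_w (\1_A w : R) = fine (Q A).
Proof. by move=> mA; rewrite /Rintegral integral_indic// setIT. Qed.

Let ge0_le_Rintegral_negligible (f g : T -> R) (N : set T) :
  Q.-negligible N ->
  Q.-integrable setT (fun w => (f w)%:E) ->
  Q.-integrable setT (fun w => (g w)%:E) ->
  (forall w, 0 <= f w) -> (forall w, 0 <= g w) ->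
  (forall w, ~ N w -> f w <= g w) -> \int[Q]_w f w <= \int[Q]_w g w.
Proof.
move=> N0 fi gi f0 g0 fg; rewrite -lee_fin !EFin_Rintegral//.
apply: ae_ge0_le_integral => //.
- by move=> w _; rewrite lee_fin.
- by case/integrableP : fi.
- by move=> w _; rewrite lee_fin.
- by case/integrableP : gi.
apply: negligibleS N0 => w /= nfg; apply: contrapT => nN; apply: nfg => _.
by rewrite lee_fin fg.
Qed.

(** Adding [|f| + |g|] to both sides makes the integrands nonnegative, where the almost everywhere
    comparison applies. *)
Lemma le_Rintegral_negligible (f g : T -> R) (N : set T) : Q.-negligible N ->
  Q.-integrable setT (fun w => (f w)%:E) ->
  Q.-integrable setT (fun w => (g w)%:E) ->
  (forall w, ~ N w -> f w <= g w) -> \int[Q]_w f w <= \int[Q]_w g w.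
Proof.
move=> N0 fi gi fg; pose h w := `|f w| + `|g w|.
have hi : Q.-integrable setT (fun w => (h w)%:E).
  by apply: integrable_EFinD; exact: integrable_norm.
rewrite -(lerD2r (\int[Q]_w h w)) -!RintegralD//.
apply: (ge0_le_Rintegral_negligible N0).
- exact: integrable_EFinD.
- exact: integrable_EFinD.
- move=> w; rewrite /h; have := ler_norm (- f w); have := normr_ge0 (g w).
  by rewrite normrN; lra.
- move=> w; rewrite /h; have := ler_norm (- g w); have := normr_ge0 (f w).
  by rewrite normrN; lra.
- by move=> w nN; rewrite lerD2r fg.
Qed.

Context {D : nat}.
Implicit Types H G : T -> euclidean R D.

Definition L2 H := measurable_fun setT H /\
  Q.-integrable setT (fun w => (edot (H w) (H w))%:E).

Lemma L2_edot H G : L2 H -> L2 G ->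
  Q.-integrable setT (fun w => (edot (H w) (G w))%:E).
Proof.
move=> [mH iH] [mG iG].
apply: (integrable_dominated (measurable_edot mH mG) (integrable_EFinD iH iG)).
by move=> w; exact: edot_le_half.
Qed.

Lemma L2D H G : L2 H -> L2 G -> L2 (fun w => (H w : 'rV[R]_D) + G w).
Proof.
move=> LH LG; have [[mH iH] [mG iG]] := (LH, LG).
split; first exact: measurable_funD_euclidean.
rewrite (_ : (fun w => _) = fun w => (edot (H w) (H w) + (edot (G w) (G w)
   + 2 * edot (H w) (G w)))%:E).
  do 2 (apply: integrable_EFinD => //).
  by apply: integrable_EFinZ; exact: L2_edot.
by apply/funext => w; rewrite !edotE (edotC (G w)); congr EFin; lra.
Qed.

Lemma L2Z (k : R) H : L2 H -> L2 (fun w => k *: (H w : 'rV[R]_D)).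
Proof.
move=> [mH iH]; split; first exact: measurable_funZ_euclidean.
under eq_fun do rewrite edotZl edotZr.
by do 2 apply: integrable_EFinZ.
Qed.

Lemma L2B H G : L2 H -> L2 G -> L2 (fun w => (H w : 'rV[R]_D) - G w).
Proof.
move=> LH LG; under eq_fun do rewrite -scaleN1r.
by apply: L2D => //; exact: L2Z.
Qed.

Lemma L2_cst (c : 'rV[R]_D) : L2 (fun=> c).
Proof. by split; [exact: measurable_cst|exact: integrable_EFin_cst]. Qed.

Lemma L2_sum I (r : seq I) (F : I -> T -> euclidean R D) :
  (forall i, L2 (F i)) ->
  L2 (fun w => \sum_(i <- r) (F i w : 'rV[R]_D)).
Proof.
move=> LF; elim: r => [|i r ih].
  by under eq_fun do rewrite big_nil; exact: L2_cst.
by under eq_fun do rewrite big_cons; exact: L2D.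
Qed.

End L2_theory.

Section laws.
Context d {T : measurableType d} {R : realType} (Q : probability T R).
Context d' {S : measurableType d'}.
Implicit Types (X : T -> S) (m : probability S R).

(** Couplings are handled as pairs of random variables on a common probability space. Laws are
    compared on measurable sets only, as measures that agree there may differ as functions. *)
Definition has_law X m := measurable_fun setT X /\
  forall A, measurable A -> Q (X @^-1` A) = m A.

Lemma law_ge0_integral X m (f : S -> \bar R) : has_law X m ->
  measurable_fun setT f -> (forall x, 0 <= f x)%E ->
  (\int[Q]_w f (X w) = \int[m]_x f x)%E.
Proof.
move=> [mX Xm] mf f0.
rewrite [RHS](eq_measure_integral (pushforward Q X)); last first.
  by move=> A mA _; apply/esym; exact: Xm.
by rewrite ge0_integral_pushforward// => x _; exact: f0.
Qed.

Lemma law_integrable X m (f : S -> R) : has_law X m ->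
  m.-integrable setT (EFin \o f) ->
  Q.-integrable setT (fun w => (f (X w))%:E).
Proof.
move=> Xm /integrableP[/measurable_EFinP mf foo].
apply/integrableP; split.
  by apply/measurable_EFinP; apply: measurableT_comp => //; exact: Xm.1.
rewrite (law_ge0_integral (f := fun x => `|(f x)%:E|%E) Xm)//.
by apply/measurable_EFinP; exact: measurableT_comp.
Qed.

Lemma law_Rintegral X m (f : S -> R) : has_law X m ->
  m.-integrable setT (EFin \o f) -> \int[Q]_w f (X w) = \int[m]_x f x.
Proof.
move=> Xm fi; have := law_integrable Xm fi; move: (Xm) => [mX Xm'] fXi.
rewrite /Rintegral; congr fine.
rewrite [RHS](eq_measure_integral (pushforward Q X)); last first.
  by move=> A mA _; apply/esym; exact: Xm'.
by rewrite integral_pushforward//; case/integrableP : fi.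
Qed.

End laws.

Lemma law_comp d1 d2 d3 (T1 : measurableType d1) (T2 : measurableType d2)
    (T3 : measurableType d3) (R : realType) (m1 : probability T1 R)
    (m2 : probability T2 R) (m3 : probability T3 R) (X : T1 -> T2)
    (Y : T2 -> T3) :
  has_law m1 X m2 -> has_law m2 Y m3 -> has_law m1 (fun w => Y (X w)) m3.
Proof.
move=> [mX Xm] [mY Ym]; split; first exact: measurableT_comp mY mX.
move=> A mA; rewrite -Ym// -Xm// -[X in measurable X]setTI.
exact: mY.
Qed.

Section product_laws.
Context d1 d2 {T1 : measurableType d1} {T2 : measurableType d2} {R : realType}.
Variables (m1 : probability T1 R) (m2 : probability T2 R).

Lemma product_law_fst : has_law (m1 \x m2)%E fst m1.
Proof.
split; first exact: measurable_fst.
move=> A mA; have -> : fst @^-1` A = A `*` [set: T2].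
  by apply/seteqP; split => -[x y]//= [].
transitivity (m1 A * m2 setT)%E; first exact: product_measure1E.
transitivity (m1 A * 1)%E; last by rewrite mule1.
by congr (_ * _)%E; exact: probability_setT.
Qed.

Lemma product_law_snd : has_law (m1 \x m2)%E snd m2.
Proof.
split; first exact: measurable_snd.
move=> A mA; have -> : snd @^-1` A = [set: T1] `*` A.
  by apply/seteqP; split => -[x y]//= [].
transitivity (m1 setT * m2 A)%E; first exact: product_measure1E.
transitivity (1 * m2 A)%E; last by rewrite mul1e.
by congr (_ * _)%E; exact: probability_setT.
Qed.

End product_laws.

Section P2_laws.
Context d {T : measurableType d} {R : realType} (Q : probability T R) {D : nat}.
Implicit Types (X : T -> euclidean R D) (mu : P2 R D).

Lemma P2_integrable mu : mu.-integrable setT (fun x => (edot x x)%:E).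
Proof.
apply: ge0_integrable_EFin => //; first exact: measurable_edot.
  by move=> x; exact: edot_ge0.
by have := P2_moment mu; under eq_integral do rewrite enorm_sqr.
Qed.

Lemma law_L2 X mu : has_law Q X mu -> L2 Q X.
Proof.
move=> Xmu; split; first exact: Xmu.1.
exact: (law_integrable (f := fun x : euclidean R D => edot x x) Xmu
  (P2_integrable mu)).
Qed.

(** Provides the competitors for the barycenter problem: perturbing a square-integrable vector in a
    square-integrable direction yields again a point of [P2]. *)
Lemma L2_has_law X : L2 Q X -> exists mu, has_law Q X mu.
Proof.
move=> [mX iX].
pose m : probability (euclidean R D) R :=
  distribution Q (HB.pack X (isMeasurableFun.Build _ _ _ _ X mX)).
suff mm : (\int[m]_x (enorm x ^+ 2)%:E < +oo)%E by exists (MkP2 mm).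
rewrite ge0_integral_pushforward//.
- under eq_integral do rewrite /= enorm_sqr.
  by rewrite -EFin_Rintegral// ltry.
- apply/measurable_EFinP; under eq_fun do rewrite enorm_sqr.
  exact: measurable_edot.
- by move=> x _; rewrite lee_fin sqr_ge0.
Qed.

End P2_laws.

Section transport_cost.
Context {R : realType} {D : nat}.
Implicit Types (mu nu : P2 R D).

Lemma has_law_id mu : has_law mu (fun x : euclidean R D => x) mu.
Proof. by split. Qed.

Lemma P2_L2_id mu : L2 mu (fun x : euclidean R D => x).
Proof. exact: law_L2 (has_law_id mu). Qed.

Lemma couplings_law mu nu pi : couplings mu nu pi ->
  has_law pi (fst : euclidean R D * euclidean R D -> euclidean R D) mu /\
  has_law pi (snd : euclidean R D * euclidean R D -> euclidean R D) nu.
Proof.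
move=> c; split; split => // A mA; have [c1 c2] := c _ mA.
  by rewrite -c1; congr (pi _); apply/seteqP; split => -[x y]//= [].
by rewrite -c2; congr (pi _); apply/seteqP; split => -[x y]//= [].
Qed.

Lemma law_couplings d (T : measurableType d) (Q : probability T R)
    (X Y : T -> euclidean R D) mu nu : has_law Q X mu -> has_law Q Y nu ->
  exists2 pi, couplings mu nu pi &
    forall f : euclidean R D * euclidean R D -> R, measurable_fun setT f ->
    (forall z, 0 <= f z) ->
    (\int[pi]_z (f z)%:E = \int[Q]_w (f (X w, Y w))%:E)%E.
Proof.
move=> [mX Xmu] [mY Ynu].
have mXY : measurable_fun setT (fun w => (X w, Y w)).
  by apply/measurable_fun_pairP; split.
exists (distribution Q (HB.pack (fun w => (X w, Y w))
  (isMeasurableFun.Build _ _ _ _ (fun w => (X w, Y w)) mXY))).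
  move=> A mA; split; rewrite /distribution/= /pushforward.
    by rewrite -Xmu//; congr (Q _); apply/seteqP; split => w //= [].
  by rewrite -Ynu//; congr (Q _); apply/seteqP; split => w //= [].
move=> f mf f0; rewrite ge0_integral_pushforward//.
  exact/measurable_EFinP.
by move=> z _; rewrite lee_fin.
Qed.

Definition sqdist (z : euclidean R D * euclidean R D) : R :=
  edot ((z.1 : 'rV[R]_D) - z.2) ((z.1 : 'rV[R]_D) - z.2).

Lemma sqdist_ge0 z : 0 <= sqdist z. Proof. exact: edot_ge0. Qed.

Lemma measurable_sqdist : measurable_fun setT sqdist.
Proof. by apply: measurable_edot; apply: measurable_funB_euclidean. Qed.

Let ecost mu nu := ereal_inf [set \int[pi]_z (sqdist z)%:E
             | pi in couplings mu nu]%E.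

Let ecost_ge0 mu nu : (0 <= ecost mu nu)%E.
Proof.
apply: le_ereal_inf_tmp => _ [pi _ <-].
by apply: integral_ge0 => z _; rewrite lee_fin sqdist_ge0.
Qed.

(** The squared distance as a real number. The product coupling has finite cost, so the infimum is
    finite and [fine] loses nothing. *)
Definition cost mu nu : R := fine (ecost mu nu).

Lemma law_sqdist_integrable d (T : measurableType d) (Q : probability T R)
    (X Y : T -> euclidean R D) mu nu : has_law Q X mu -> has_law Q Y nu ->
  Q.-integrable setT (fun w => (sqdist (X w, Y w))%:E).
Proof.
by move=> Xmu Ynu; exact: (L2B (law_L2 Xmu) (law_L2 Ynu)).2.
Qed.

Let ecost_le d (T : measurableType d) (Q : probability T R)
    (X Y : T -> euclidean R D) mu nu : has_law Q X mu -> has_law Q Y nu ->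
  (ecost mu nu <= (\int[Q]_w sqdist (X w, Y w))%:E)%E.
Proof.
move=> Xmu Ynu; have [pi cpi pif] := law_couplings Xmu Ynu.
rewrite EFin_Rintegral; last exact: law_sqdist_integrable Xmu Ynu.
rewrite -pif; [|exact: measurable_sqdist|exact: sqdist_ge0].
by apply: ereal_inf_lbound; exists pi.
Qed.

Lemma prod_coupling mu nu : couplings mu nu (mu \x nu)%E.
Proof.
move=> A mA; split.
  rewrite -(product_law_fst mu nu).2//; congr ((_ \x _)%E _).
  by apply/seteqP; split => -[x y]//= [].
rewrite -(product_law_snd mu nu).2//; congr ((_ \x _)%E _).
by apply/seteqP; split => -[x y]//= [].
Qed.

Lemma cost_ge0 mu nu : 0 <= cost mu nu.
Proof. by rewrite fine_ge0// ecost_ge0. Qed.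

Let EFin_cost mu nu : (cost mu nu)%:E = ecost mu nu.
Proof.
have [l1 l2] := couplings_law (prod_coupling mu nu).
rewrite /cost fineK// ge0_fin_numE ?ecost_ge0//.
by rewrite (le_lt_trans (ecost_le l1 l2))// ltry.
Qed.

Lemma W2_sqr mu nu : (W2 mu nu ^+ 2 = (cost mu nu)%:E)%E.
Proof.
rewrite /W2 (_ : ereal_inf _ = (cost mu nu)%:E); last first.
  rewrite EFin_cost; congr ereal_inf; apply/seteqP; split => _ [pi c <-];
  by exists pi => //; apply: eq_integral => z _; rewrite enorm_sqr.
rewrite poweR_EFin powR12_sqrt ?cost_ge0// -EFin_expe sqr_sqrtr//.
exact: cost_ge0.
Qed.

Lemma W2_ltP mu nu (r : R) : 0 < r ->
  (W2 mu nu < r%:E)%E = (cost mu nu < r ^+ 2).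
Proof.
move=> r0; rewrite /W2 (_ : ereal_inf _ = (cost mu nu)%:E); last first.
  rewrite EFin_cost; congr ereal_inf; apply/seteqP; split => _ [pi c <-];
  by exists pi => //; apply: eq_integral => z _; rewrite enorm_sqr.
rewrite poweR_EFin powR12_sqrt ?cost_ge0// lte_fin.
by rewrite -[in RHS](sqr_sqrtr (cost_ge0 mu nu)) ltr_pXn2r// nnegrE ?sqrtr_ge0
  ?ltW.
Qed.

Lemma cost_le d (T : measurableType d) (Q : probability T R)
    (X Y : T -> euclidean R D) mu nu : has_law Q X mu -> has_law Q Y nu ->
  cost mu nu <= \int[Q]_w sqdist (X w, Y w).
Proof. by move=> Xmu Ynu; rewrite -lee_fin EFin_cost; exact: ecost_le. Qed.

Lemma cost_lb mu nu c : (forall pi, couplings mu nu pi ->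
    c <= \int[pi]_z sqdist z) -> c <= cost mu nu.
Proof.
move=> h; rewrite -lee_fin EFin_cost; apply: le_ereal_inf_tmp => _ [pi cpi <-].
have [l1 l2] := couplings_law cpi.
have := law_sqdist_integrable l1 l2.
under eq_fun do rewrite -surjective_pairing.
by move=> /EFin_Rintegral <-; rewrite lee_fin; exact: h.
Qed.

(** Almost optimal couplings suffice throughout, so no compactness of the set of couplings is
    invoked. *)
Lemma cost_approx mu nu e : 0 < e -> exists2 pi, couplings mu nu pi &
  \int[pi]_z sqdist z < cost mu nu + e.
Proof.
move=> e0; apply: contrapT => h.
suff : cost mu nu + e <= cost mu nu by rewrite gerDl leNgt e0.
apply: cost_lb => pi cpi; rewrite leNgt; apply/negP => lt.
by apply: h; exists pi.
Qed.

Lemma cost_self mu : cost mu mu = 0.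
Proof.
apply/le_anti; rewrite cost_ge0 andbT.
apply: (le_trans (cost_le (has_law_id mu) (has_law_id mu))).
under eq_Rintegral do rewrite /sqdist/= subrr edot0l.
by rewrite Rintegral_cst// mul0r.
Qed.

Lemma cost_sym mu nu : cost mu nu = cost nu mu.
Proof.
wlog suff : mu nu / cost nu mu <= cost mu nu.
  by move=> h; apply/le_anti; rewrite !h.
apply: cost_lb => pi /couplings_law[l1 l2].
apply: (le_trans (cost_le l2 l1)).
rewrite le_eqVlt; apply/orP; left; apply/eqP/eq_Rintegral => z _.
by rewrite /sqdist/= -opprB edotNl edotNr opprK.
Qed.

End transport_cost.

(** * Gluing and the triangle inequality *)

Lemma measurable_fun_nat d (T : measurableType d) (f : T -> nat) :
  (forall j, measurable (f @^-1` [set j])) -> measurable_fun setT f.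
Proof.
move=> mf _ Y _; rewrite setTI (_ : f @^-1` Y = \bigcup_(j in Y) f @^-1` [set
  j]).
  by apply: bigcup_measurable => j _.
by apply/seteqP; split => [x Yx|x [j Yj /= ->]//]; exists (f x).
Qed.

(** The cells are those of a cubic grid of mesh [e], numbered by the codes of the integer vectors of
    floors; two points of a cell differ by at most [e] in each coordinate. *)
Lemma countable_cells (R : realType) (D : nat) (delta : R) : 0 < delta ->
  exists2 idx : euclidean R D -> nat, measurable_fun setT idx &
    forall x y, idx x = idx y -> sqdist (x, y) <= delta.
Proof.
move=> d0; pose e := Num.sqrt (delta / D.+1%:R).
have e0 : 0 < e by rewrite sqrtr_gt0 divr_gt0.
pose q (x : euclidean R D) : 'rV[int]_D :=
  \row_i Num.floor ((x : 'rV[R]_D) 0 i / e).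
exists (fun x => pickle (q x)).
  apply: measurable_fun_nat => j.
  have [[c cj]|jn] := pselect (exists c : 'rV[int]_D, pickle c = j); last first.
    rewrite (_ : _ @^-1` _ = set0) -?subset0// => x /= xj.
    by apply: jn; exists (q x).
  rewrite (_ : _ @^-1` _ = \bigcap_(i in [set: 'I_D])
      (fun x : euclidean R D => (x : 'rV[R]_D) 0 i / e) @^-1`
        `[(c 0 i)%:~R, (c 0 i + 1)%:~R[%classic).
    apply: fin_bigcap_measurable => // i _; rewrite -[X in measurable X]setTI.
    apply: (measurable_funM (measurable_coord i) (measurable_cst _)) => //.
  apply/seteqP; split => x /=.
    rewrite -cj => /(pcan_inj pickleK) <- i _ /=.
    by rewrite mxE in_itv/= floor_itv.
  move=> xc; rewrite -cj; congr pickle; apply/rowP => i; rewrite mxE.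
  by apply/eqP; rewrite floor_eq; have := xc i I; rewrite /= in_itv.
move=> x y /(pcan_inj pickleK) qxy.
apply: (le_trans (@edot_small _ _ _ e _)).
  move=> i; have := congr1 (fun c : 'rV[int]_D => c 0 i) qxy; rewrite !mxE/=.
  move=> fxy; have := floor_itv ((y : 'rV[R]_D) 0 i / e).
  have := floor_itv ((x : 'rV[R]_D) 0 i / e).
  rewrite fxy; set k := Num.floor _.
  rewrite intrD !ler_pdivlMr// !ltr_pdivrMr// mulrDl mul1r.
  move: (k%:~R * e) => a /andP[? ?] /andP[? ?].
  by rewrite ler_norml; apply/andP; split; lra.
rewrite sqr_sqrtr; last by rewrite divr_ge0// ltW.
by rewrite mulrCA -[leRHS]mulr1 ler_pM2l// ler_pdivrMr// mul1r ler_nat.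
Qed.

Section gluing.
Context d1 d2 {T1 : measurableType d1} {T2 : measurableType d2} {R : realType}.
Variables (m1 : probability T1 R) (m2 : probability T2 R).
Variables (L1 : T1 -> nat) (L2 : T2 -> nat).
Hypotheses (mL1 : measurable_fun setT L1) (mL2 : measurable_fun setT L2).
Hypothesis L12 : forall j, m1 (L1 @^-1` [set j]) = m2 (L2 @^-1` [set j]).

Let A j := L1 @^-1` [set j].
Let B j := L2 @^-1` [set j].

Let mA j : measurable (A j).
Proof. by rewrite -[X in measurable X]setTI; exact: mL1. Qed.

Let mB j : measurable (B j).
Proof. by rewrite -[X in measurable X]setTI; exact: mL2. Qed.

Let p j : R := fine (m1 (A j)).

Let pE1 j : m1 (A j) = (p j)%:E.
Proof. by rewrite /p fineK// fin_num_measure. Qed.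

Let pE2 j : m2 (B j) = (p j)%:E.
Proof. by rewrite -pE1 L12. Qed.

Let p0 j : 0 <= (p j)^-1.
Proof. by rewrite invr_ge0 fine_ge0. Qed.

(** Conditionally on the common label [j] the two components are independent: up to normalization by
    the mass of the cell, the piece is the product of the two restrictions. *)
Let piece j : {measure set (T1 * T2) -> \bar R} :=
  mscale (NngNum (p0 j)) (mrestr m1 (mA j) \x mrestr m2 (mB j))%E.

Let pieceE j (U : set T1) (V : set T2) : measurable U -> measurable V ->
  piece j (U `*` V) =
  (((p j)^-1)%:E * (m1 (U `&` A j) * m2 (V `&` B j)))%E.
Proof. by move=> mU mV; congr (_ * _)%E; exact: product_measure1E. Qed.

Let piece1 j (U : set T1) : measurable U ->
  piece j (U `*` setT) = m1 (U `&` A j).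
Proof.
move=> mU; rewrite pieceE// setTI pE2.
have : (m1 (U `&` A j) <= (p j)%:E)%E by rewrite -pE1 measureIr.
rewrite -(@fineK _ (m1 (U `&` A j))) ?fin_num_measure//;
  last exact: measurableI.
rewrite -!EFinM lee_fin; set u := fine _ => up.
have u0 : 0 <= u by rewrite fine_ge0.
(* For a cell of mass zero the convention [0^-1 = 0] is harmless, as both sides vanish. *)
have [pj0|pj0] := eqVneq (p j) 0; last by rewrite mulrCA mulVf ?mulr1.
by rewrite pj0 mulr0 mulr0; congr EFin; apply/le_anti; rewrite u0 -pj0 up.
Qed.

Let piece2 j (V : set T2) : measurable V ->
  piece j (setT `*` V) = m2 (V `&` B j).
Proof.
move=> mV; rewrite pieceE// setTI pE1.
have : (m2 (V `&` B j) <= (p j)%:E)%E by rewrite -pE2 measureIr.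
rewrite -(@fineK _ (m2 (V `&` B j))) ?fin_num_measure//;
  last exact: measurableI.
rewrite -!EFinM lee_fin; set u := fine _ => up.
have u0 : 0 <= u by rewrite fine_ge0.
have [pj0|pj0] := eqVneq (p j) 0; last by rewrite mulrA mulVf ?mul1r.
by rewrite pj0 mul0r mulr0; congr EFin; apply/le_anti; rewrite u0 -pj0 up.
Qed.

Let partition d (T : measurableType d) (m : probability T R) (L : T -> nat)
    (mL : measurable_fun setT L) (U : set T) : measurable U ->
  (\sum_(j <oo) m (U `&` L @^-1` [set j]) = m U)%E.
Proof.
move=> mU; have -> : m U = m (\bigcup_j (U `&` L @^-1` [set j])).
  by congr (m _); apply/seteqP; split => [x Ux|x [_ _ []//]]; exists (L x).
apply/cvg_lim => //; apply: measure_semi_sigma_additive.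
- move=> j; apply: measurableI => //; rewrite -[X in measurable X]setTI.
  exact: mL.
- by apply/trivIsetP => i j _ _ /eqP ij;
    rewrite -subset0 => x [[_ /= Li] [_ /= Lj]]; apply: ij; rewrite -Li.
- apply: bigcupT_measurable => j; apply: measurableI => //.
  by rewrite -[X in measurable X]setTI; exact: mL.
Qed.

Let glued := mseries piece 0.

Let glued1 (U : set T1) : measurable U -> glued (U `*` setT) = m1 U.
Proof.
move=> mU; rewrite /glued /mseries.
by under eq_eseriesr do rewrite piece1//; exact: partition.
Qed.

Let glued2 (V : set T2) : measurable V -> glued (setT `*` V) = m2 V.
Proof.
move=> mV; rewrite /glued /mseries.
by under eq_eseriesr do rewrite piece2//; exact: partition.
Qed.

Let gluedT : glued setT = 1%E.
Proof. by rewrite -setXTT glued1// probability_setT. Qed.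

(** Applied to the grid label of a shared marginal, this composes two couplings up to a small error;
    applied to coarse labels of two measures, it couples them cell by cell. A piece [j] charges
    [A k] times [B l] only when [j = k = l], which makes unequal labels negligible. *)
Lemma gluing : exists Q : probability (T1 * T2)%type R,
  [/\ has_law Q fst m1, has_law Q snd m2 &
      Q.-negligible [set z | L1 z.1 <> L2 z.2]].
Proof.
pose Q : probability (T1 * T2)%type R :=
  HB.pack (mseries piece 0)
    (Measure_isProbability.Build _ _ _ (mseries piece 0) gluedT).
exists Q; split.
- split=> [|U mU]; first exact: measurable_fst.
  transitivity (glued (U `*` setT)); last exact: glued1.
  by congr (glued _); apply/seteqP; split => -[x y]//= [].
- split=> [|V mV]; first exact: measurable_snd.
  transitivity (glued (setT `*` V)); last exact: glued2.
  by congr (glued _); apply/seteqP; split => -[x y]//= [].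
apply: (@negligibleS _ _ _ _ (\bigcup_k \bigcup_l
    (if k == l then set0 else A k `*` B l))).
  move=> [x y]/= xy; exists (L1 x) => //; exists (L2 y) => //.
  by case: eqP.
apply: negligible_bigcup => k; apply: negligible_bigcup => l.
have [_|kl] := eqVneq k l; first exact: negligible_set0.
apply/negligibleP; first exact: measurableX.
rewrite /= /glued /mseries eseries0// => j _ _; rewrite pieceE//.
have [jk|jk] := eqVneq j k.
  rewrite (_ : B l `&` B j = set0) ?measure0 ?mule0//.
  rewrite -subset0 => x [xl xj]; case/eqP: kl; rewrite -jk.
  exact: etrans (esym xj) xl.
rewrite (_ : A k `&` A j = set0) ?measure0 ?mul0e ?mule0//.
rewrite -subset0 => x [xk xj]; case/eqP: jk; exact: etrans (esym xj) xk.
Qed.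

End gluing.

Section triangle.
Context {R : realType} {D : nat}.
Implicit Types mu nu rho : P2 R D.

Let E := euclidean R D.

(* Gluing along cells of diameter at most [delta] replaces the disintegration
   usually needed to glue two couplings along their common marginal. *)
Let couplings_triangle mu nu rho (s delta : R) pi1 pi2 : 0 < s -> 0 < delta ->
  couplings mu nu pi1 -> couplings nu rho pi2 ->
  cost mu rho <= (1 + s) * \int[pi1]_z sqdist z +
    (1 + s^-1) * (2 * \int[pi2]_z sqdist z + 2 * delta).
Proof.
move=> s0 delta0 /couplings_law[l1 l2] /couplings_law[l3 l4].
have [idx midx idxP] := @countable_cells R D _ delta0.
have [|||Q [lQ1 lQ2 N0]] := @gluing _ _ _ _ R pi1 pi2
    (fun z => idx z.2) (fun z => idx z.1).
- exact: measurableT_comp midx measurable_snd.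
- exact: measurableT_comp midx measurable_fst.
- move=> j; have mj : measurable (idx @^-1` [set j]).
    by rewrite -[X in measurable X]setTI; exact: midx.
  transitivity (nu (idx @^-1` [set j])); first exact: l2.2.
  by apply/esym; exact: l3.2.
have lX := law_comp lQ1 l1; have lY := law_comp lQ2 l4.
apply: (le_trans (cost_le lX lY)).
have i1 : Q.-integrable setT (fun w => (sqdist w.1)%:E).
  by have := law_sqdist_integrable lX (law_comp lQ1 l2).
have i2 : Q.-integrable setT (fun w => (sqdist w.2)%:E).
  by have := law_sqdist_integrable (law_comp lQ2 l3) lY.
have i4 : pi1.-integrable setT (EFin \o sqdist) by exact: law_sqdist_integrable
  l1 l2.
have i3 : pi2.-integrable setT (EFin \o sqdist) by exact: law_sqdist_integrable
  l3 l4.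
rewrite -(law_Rintegral lQ1 i4) -(law_Rintegral lQ2 i3).
have -> : 2 * delta = \int[Q]_w (2 * delta) :> R.
  by rewrite Rintegral_probability_cst.
have ic := integrable_EFin_cst Q (2 * delta).
have is2 := integrable_EFinZ 2 i2.
rewrite -!RintegralZl// -RintegralD//.
rewrite -RintegralZl//; last exact: integrable_EFinD.
rewrite -RintegralD//; [|exact: integrable_EFinZ|]; last first.
  by apply: integrable_EFinZ; exact: integrable_EFinD.
apply: (le_Rintegral_negligible N0).
- exact: law_sqdist_integrable lX lY.
- apply: integrable_EFinD; first exact: integrable_EFinZ.
  by apply: integrable_EFinZ; exact: integrable_EFinD.
move=> [[x u] [v y]] /= /contrapT/idxP uv.
exact: edot_chain s0 uv.
Qed.

(** The mesh of the gluing is sent to zero, then each coupling is optimized in turn. The factor 2 on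
    the second leg is the price of the approximate gluing; it does no harm to continuity, where that
    leg tends to zero for a fixed small [s]. *)
Lemma cost_triangle mu nu rho (s : R) : 0 < s ->
  cost mu rho <= (1 + s) * cost mu nu + (1 + s^-1) * (2 * cost nu rho).
Proof.
move=> s0; have si0 : 0 < s^-1 by rewrite invr_gt0.
have key pi1 pi2 : couplings mu nu pi1 -> couplings nu rho pi2 ->
    cost mu rho <= (1 + s) * \int[pi1]_z sqdist z +
      (1 + s^-1) * (2 * \int[pi2]_z sqdist z).
  move=> c1 c2; apply/ler_addgt0Pr => e e0.
  have d0 : 0 < e / (2 * (1 + s^-1)) by rewrite divr_gt0// mulr_gt0//; lra.
  apply: (le_trans (couplings_triangle s0 d0 c1 c2)).
  rewrite (mulrDr (1 + s^-1)) addrA lerD2l.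
  rewrite le_eqVlt; apply/orP; left; apply/eqP.
  by move: s^-1 si0 => si si0; field; rewrite gt_eqF//; lra.
have k1 pi2 : couplings nu rho pi2 -> cost mu rho <=
    (1 + s) * cost mu nu + (1 + s^-1) * (2 * \int[pi2]_z sqdist z).
  move=> c2; rewrite -lerBlDr -ler_pdivrMl; last lra.
  apply: cost_lb => pi1 c1; rewrite ler_pdivrMl; last lra.
  by rewrite lerBlDr; exact: key.
rewrite addrC -lerBlDr -ler_pdivrMl; last lra.
rewrite -ler_pdivrMl//.
apply: cost_lb => pi2 c2; rewrite ler_pdivrMl// ler_pdivrMl; last lra.
by rewrite lerBlDr addrC; exact: k1.
Qed.

End triangle.

(** * Topology of the Wasserstein space *)

Section wasserstein_topology.
Context {R : realType} {D : nat}.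
Implicit Types mu nu : P2 R D.

Lemma cost_continuous mu nu (e : R) : 0 < e -> exists2 r : R, 0 < r &
  forall nu', cost nu nu' < r -> `|cost mu nu' - cost mu nu| < e.
Proof.
move=> e0; have c0 := cost_ge0 mu nu; set c := cost mu nu in c0 *.
(* The perturbed cost will be at most [c + e + 1], so a relative error [s] amounts to at most
   [e / 4]; [r] is then small enough to absorb the large factor [1 + s^-1]. *)
pose s := e / (4 * (c + e + 1)).
have s0 : 0 < s by rewrite divr_gt0// mulr_gt0//; lra.
have sce : s * (c + e + 1) = e / 4 by rewrite /s; field; lra.
have si0 : 0 < s^-1 by rewrite invr_gt0.
pose r := e / (8 * (1 + s^-1)).
have r0 : 0 < r by rewrite divr_gt0// mulr_gt0//; lra.
have re : (1 + s^-1) * (2 * r) = e / 4.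
  by rewrite /r; move: s^-1 si0 => si si0; field; lra.
exists r => // nu' nu'r.
have h1 := cost_triangle mu nu nu' s0; have h2 := cost_triangle mu nu' nu s0.
rewrite (cost_sym nu' nu) -/c in h1 h2.
have h3 : (1 + s^-1) * (2 * cost nu nu') <= e / 4.
  rewrite -re ler_wpM2l//; first by lra.
  by rewrite ler_wpM2l// ltW.
have h4 := cost_ge0 mu nu';
  move: {nu'r} (cost mu nu') h1 h2 h3 h4 => c' h1 h2 h3 h4.
have h5 : s * c' <= s * (c + e + 1).
  rewrite ler_pM2l//; apply: (le_trans (le_trans h1 (lerD (lexx _) h3))); nra.
rewrite ltr_norml; apply/andP; split; nra.
Qed.

Lemma W2_open_cost_itv mu (a b : R) :
  W2_open [set nu : P2 R D | a < cost mu nu < b].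
Proof.
move=> nu /andP[anu nub].
have e0 : 0 < Order.min (cost mu nu - a) (b - cost mu nu).
  by rewrite lt_min !subr_gt0 anu.
have [r r0 h] := cost_continuous mu nu e0.
exists (Num.sqrt r); first by rewrite sqrtr_gt0.
move=> nu'; rewrite W2_ltP ?sqrtr_gt0// sqr_sqrtr ?ltW// => /h.
rewrite lt_min !ltr_norml => /andP[/andP[h1 _] /andP[_ h2]] /=.
by apply/andP; split; lra.
Qed.

Lemma measurable_W2_open (U : set (P2 R D)) : W2_open U ->
  measurable (U : set (wasserstein R D)).
Proof. exact: sub_sigma_algebra. Qed.

Lemma measurable_cost mu : measurable_fun setT (cost mu : wasserstein R D -> R).
Proof.
apply: (measurability _ (RGenOpens.measurableE R)).
move=> _ [_ [a [b ->] <-]]; rewrite setTI; apply: measurable_W2_open.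
rewrite (_ : _ @^-1` _ = [set nu | a < cost mu nu < b]); last first.
  by apply/seteqP; split => nu /=; rewrite in_itv.
exact: W2_open_cost_itv.
Qed.

(** The support is closed: an open null set around one point also witnesses that the nearby points
    lie outside the support. *)
Lemma supp_measurable (P : probability (wasserstein R D) R) :
  measurable (supp P : set (wasserstein R D)).
Proof.
rewrite -[X in measurable X]setCK; apply: measurableC.
apply: measurable_W2_open => mu /existsNP[U /not_implyP[oU /not_implyP[Umu
  PU]]].
have [r r0 h] := oU _ Umu; exists r => // nu /h Unu.
by apply/existsNP; exists U; do 2 (apply/not_implyP; split => //).
Qed.

End wasserstein_topology.

(** * Separability of the Wasserstein space and full measure of the support *)

Lemma uniform_prob_lt (R : realType) (t : R) : 0 <= t <= 1 ->
  uniform_prob (@ltr01 R) [set u | u < t] = t%:E.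
Proof.
move=> /andP[t0 t1]; rewrite /uniform_prob integral_uniform_pdf.
rewrite (_ : _ `&` _ = `[0, t[%classic); last first.
  apply/seteqP; split => u /=; rewrite !in_itv/=.
    by move=> [-> /andP[->]].
  by move=> /andP[u0 ut]; rewrite u0 ut; split => //;
    rewrite ltW// (lt_le_trans ut).
rewrite (eq_integral (fun=> 1%E)); last first.
  move=> u; rewrite inE/= in_itv/= => /andP[u0 ut].
  by rewrite /uniform_pdf u0 (ltW (lt_le_trans ut t1)) subr0 invr1.
rewrite integral_cst//= lebesgue_measure_itv/= lte_fin mul1e.
by case: ltP => [_|t0']; [rewrite sube0|congr EFin; apply/le_anti; rewrite t0].
Qed.

(** Both measures have total mass 1, so the masses of the positive labels determine that of label
    0. *)
Lemma law_nat_eq d1 d2 (T1 : measurableType d1) (T2 : measurableType d2)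
    (R : realType) (m1 : probability T1 R) (m2 : probability T2 R)
    (L1 : T1 -> nat) (L2 : T2 -> nat) :
  measurable_fun setT L1 -> measurable_fun setT L2 ->
  (forall j, m1 (L1 @^-1` [set j.+1]) = m2 (L2 @^-1` [set j.+1])) ->
  forall j, m1 (L1 @^-1` [set j]) = m2 (L2 @^-1` [set j]).
Proof.
move=> mL1 mL2 L12; case=> [|j]; last by apply: L12.
suff H d (T : measurableType d) (m : probability T R) (L : T -> nat) :
    measurable_fun setT L -> (m (L @^-1` [set 0%N]) =
      1 - \sum_(0 <= j <oo) m (L @^-1` [set j.+1]))%E.
  by rewrite !H//; congr (_ - _)%E; apply: eq_eseriesr => j _; exact: L12.
move=> mL; have mLj j : measurable (L @^-1` [set j]).
  by rewrite -[X in measurable X]setTI; exact: mL.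
rewrite (_ : L @^-1` [set 0%N] = ~` (\bigcup_j L @^-1` [set j.+1])).
  rewrite probability_setC; last by apply: bigcupT_measurable => j.
  rewrite measure_bigcup//; last first.
    apply/trivIsetP => i j _ _ /eqP ij; rewrite -subset0 => x [/= xi xj].
    by apply: ij; move: xj; rewrite xi => -[].
  by congr (_ - _)%E; apply: eq_eseriesl => j; rewrite in_setT.
apply/seteqP; split => x /=; first by move=> x0 [j _ /=]; rewrite x0.
move=> nx; case xj : (L x) => [//|j]; exfalso; apply: nx.
by exists j.
Qed.

Section separability.
Context {R : realType} {D : nat}.
Let E := euclidean R D.
Let lambda : probability (measurableTypeR R) R := uniform_prob (@ltr01 R).

Lemma uniform_prob_ge (t : R) : 0 <= t <= 1 ->
  uniform_prob (@ltr01 R) [set u | t <= u] = (1 - t)%:E.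
Proof.
move=> t01; have mt : measurable [set u : R | u < t].
  by rewrite -set_itvNyo; exact: measurable_itv.
rewrite (_ : [set u | t <= u] = ~` [set u | u < t]); last first.
  apply/seteqP; split => u /=; first by rewrite leNgt => /negP.
  by move/negP; rewrite -leNgt.
by rewrite probability_setC// EFinB; congr (_ - _)%E; exact: uniform_prob_lt.
Qed.

Lemma cell_bound (idx : E -> nat) (delta : R) :
  (forall x y, idx x = idx y -> sqdist (x, y) <= delta) ->
  exists2 B : nat -> R, (forall j, 0 <= B j) & forall x, edot x x <= B (idx x).
Proof.
move=> hidx.
have /choice[B hB] : forall j, exists b : R, 0 <= b /\ forall x, idx x = j ->
  edot x x <= b.
  move=> j; have [[y yj]|nj] := pselect (exists y, idx y = j); last first.
    by exists 0; split => // x xj; case: nj; exists x.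
  exists (2 * delta + 2 * edot y y); split.
    have := hidx y y erefl; have := sqdist_ge0 (y, y); have := edot_ge0 y; lra.
  move=> x xj; have := edot_normD ((x : 'rV[R]_D) - y) y (@ltr01 R).
  have := hidx x y; rewrite xj yj => /(_ erefl); rewrite /sqdist/= subrK invr1.
  by move=> ? ?; lra.
by exists B => [j|x]; [have [] := hB j|have [_] := hB (idx x); exact].
Qed.

Lemma cell_tail (mu : P2 R D) (idx : E -> nat) (e : R) :
  measurable_fun setT idx -> 0 < e -> exists J : nat,
  \int[mu]_x (edot x x * \1_[set x | (J <= idx x)%N] x) < e.
Proof.
move=> midx e0.
pose h (J : nat) (x : E) := edot x x * \1_[set x | (J <= idx x)%N] x.
have mJ (J : nat) : measurable [set x | (J <= idx x)%N].
  rewrite (_ : [set x | _] = idx @^-1` [set j | (J <= j)%N])//.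
  by rewrite -[X in measurable X]setTI; exact: midx.
have mh J : measurable_fun setT (h J).
  by apply: measurable_funM; [exact: measurable_edot|exact: measurable_indic].
have : (\int[mu]_x (h J x)%:E @[J --> \oo] --> \int[mu]_x (cst 0 x : \bar R))%E.
  apply: (@dominated_cvg _ _ _ mu setT measurableT (fun J x => (h J x)%:E)
    (cst 0%E) (fun x => (edot x x)%:E)) => //.
  - by move=> J; exact/measurable_EFinP.
  - move=> x _; apply: (@cvg_near_cst _ _ _ _ _); near=> J.
    rewrite /h indicE memNset ?mulr0//=; apply/negP; rewrite -ltnNge.
    by near: J; exact: nbhs_infty_gt.
  - exact: P2_integrable.
  - move=> J x _; rewrite lee_fin normrM !ger0_norm ?edot_ge0//.
    by rewrite ler_piMr ?edot_ge0// indicE; case: (_ \in _).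
rewrite integral0 => /fine_cvgP[_ /cvgrPdist_lt/(_ e e0)] [J _ /(_ J (leqnn
  J))].
rewrite sub0r normrN /= => lte; exists J.
by apply: le_lt_trans lte; exact: ler_norm.
Unshelve. all: by end_near. Qed.

Let p (idx : E -> nat) (mu : P2 R D) j : R := fine (mu (idx @^-1` [set j])).

Let c idx mu (J N j : nat) : R :=
  if (j < J)%N then (Num.truncn (N.+1%:R * p idx mu j))%:R / N.+1%:R else 0.

Let I01 : measurableType _ := measurableTypeR R.

Let randomized (mu : P2 R D) : probability (E * I01)%type R :=
  (mu \x lambda)%E.

(* The auxiliary uniform variable splits off mass exactly [c idx mu J N j] from
   cell [j], so the law of [L] depends on [mu] only through rounded masses. *)
Lemma cell_label (idx : E -> nat) (B : nat -> R) (mu : P2 R D) (J N : nat) :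
  measurable_fun setT idx -> (forall j, 0 <= B j) ->
  (forall x, edot x x <= B (idx x)) ->
  let Qm := randomized mu in exists L : E * I01 -> nat, [/\ measurable_fun setT
    L,
    forall z, L z = 0%N \/ L z = (idx z.1).+1,
    forall j, Qm (L @^-1` [set j.+1]) = (c idx mu J N j)%:E &
    \int[Qm]_z (edot z.1 z.1 * \1_[set z | L z = 0%N] z) <=
    \int[mu]_x (edot x x * \1_[set x | (J <= idx x)%N] x) +
    \sum_(j < J) B j / N.+1%:R].
Proof.
move=> midx B0 hB Qm.
have mA j : measurable (idx @^-1` [set j]).
  by rewrite -[X in measurable X]setTI; exact: midx.
have p0 j : 0 <= p idx mu j by exact: fine_ge0.
have pE j : mu (idx @^-1` [set j]) = (p idx mu j)%:E.
  by rewrite /p fineK// fin_num_measure.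
(* [t j] is the fraction of cell [j] that keeps its label. In each of the first [J] cells, rounding
   down discards at most [N.+1%:R^-1] of the mass. *)
pose cj := c idx mu J N; pose t j := cj j / p idx mu j.
have cj0 j : 0 <= cj j by rewrite /cj /c; case: ifP => // _; rewrite divr_ge0.
have cjp j : cj j <= p idx mu j.
  rewrite /cj /c; case: ifP => // _; rewrite ler_pdivrMr// [leRHS]mulrC.
  by have /andP[] := truncn_itv (mulr_ge0 (ler0n R N.+1) (p0 j)).
have pcj j : (j < J)%N -> p idx mu j - cj j <= N.+1%:R^-1.
  move=> jJ; rewrite /cj /c jJ.
  have /andP[_] := truncn_itv (mulr_ge0 (ler0n R N.+1) (p0 j)).
  move: (Num.truncn _) => m; rewrite -[m.+1%:R]natr1 addrC mulrC => /ltW mp.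
  by rewrite lerBlDr -[X in X + _]mul1r -mulrDl ler_pdivlMr.
have tp j : t j * p idx mu j = cj j.
  rewrite /t; have [pj|pj] := eqVneq (p idx mu j) 0; last by rewrite divfK.
  by apply/eqP; rewrite pj mulr0 eq_le cj0 -pj cjp.
have t01 j : 0 <= t j <= 1.
  rewrite divr_ge0//= /t; have [->|pj] := eqVneq (p idx mu j) 0.
    by rewrite invr0 mulr0.
  by rewrite ler_pdivrMr ?mul1r// lt_def pj p0.
(* Label 0 is reserved for the discarded mass, hence the shift by one on the cells. *)
pose L (z : E * I01) := if z.2 < t (idx z.1) then (idx z.1).+1 else 0%N.
have LS j : L @^-1` [set j.+1] =
    (idx @^-1` [set j]) `*` ([set u | u < t j] : set I01).
  apply/seteqP; split => [[x u]|[x u] [/= <-]]; rewrite /L /=;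
    last by move=> ->.
  by case: ifP => // ut [<-].
pose Z j := (idx @^-1` [set j]) `*` ([set u | t j <= u] : set I01).
have L0 : L @^-1` [set 0%N] = \bigcup_j Z j.
  apply/seteqP; split => [[x u]|[x u] [j _ [/= <-]]]; rewrite /L /=.
    by case: ltP => // tu _; exists (idx x).
  by rewrite ltNge => ->.
have mlt (s : R) : measurable ([set u | u < s] : set I01).
  by rewrite -set_itvNyo; exact: measurable_itv.
have mge (s : R) : measurable ([set u | s <= u] : set I01).
  by rewrite -set_itvcy; exact: measurable_itv.
have mZ j : measurable (Z j) by exact: measurableX.
have mL0 : measurable [set z | L z = 0%N].
  by move: L0; rewrite /preimage => ->; exact: bigcupT_measurable.
have mL : measurable_fun setT L.
  apply: measurable_fun_nat => -[|j]; last first.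
    by rewrite LS; exact: measurableX.
  by rewrite L0; exact: bigcupT_measurable.
have ZE j : fine (Qm (Z j)) = p idx mu j - cj j.
  have h : Qm (Z j) = ((p idx mu j)%:E * (1 - t j)%:E)%E.
    apply: (etrans (product_measure1E mu lambda (mA j) (mge (t j)))).
    by congr (_ * _)%E; [exact: pE|exact: uniform_prob_ge].
  by rewrite [X in fine X]h -EFinM /= mulrBr mulr1 mulrC tp.
exists L; split => //.
    by move=> z; rewrite /L; case: ifP; [right|left].
  move=> j; rewrite LS.
  rewrite -[X in _ = X%:E]tp mulrC EFinM.
  apply: (etrans (product_measure1E mu lambda (mA j) (mlt (t j)))).
  by congr (_ * _)%E; [exact: pE|exact: uniform_prob_lt].
have l1 := product_law_fst mu lambda.
have i1 : mu.-integrable setT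
    (EFin \o (fun x => edot x x * \1_[set x | (J <= idx x)%N] x)).
  apply: integrable_dominated (P2_integrable mu) _.
    apply: measurable_funM; first exact: measurable_edot.
    apply: measurable_indic.
    rewrite (_ : [set x | _] = idx @^-1` [set j | (J <= j)%N])//.
    by rewrite -[X in measurable X]setTI; exact: midx.
  move=> x; rewrite normrM !ger0_norm ?edot_ge0//.
  by rewrite ler_piMr ?edot_ge0// indicE; case: (_ \in _).
have i2 := law_integrable l1 i1.
have i3 j : Qm.-integrable setT
    (fun z => (B j * \1_(Z j) z)%:E).
  by apply: integrable_EFinZ; exact: integrable_indic.
have i4 : Qm.-integrable setT
    (fun z => (\sum_(j < J) B j * \1_(Z j) z)%:E).
  exact: (integrable_EFin_sum _ (fun j : 'I_J => i3 j)).
rewrite -(law_Rintegral l1 i1).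
(* A discarded point lies either in the tail [J <= idx x], or in the discarded part [Z j] of one of
   the first [J] cells, where the squared norm is at most [B j]. *)
apply: (@le_trans _ _ (\int[Qm]_z
    (edot z.1 z.1 * \1_[set x | (J <= idx x)%N] z.1 +
     \sum_(j < J) B j * \1_(Z j) z))).
  apply: le_Rintegral => //.
  - apply: integrable_dominated (law_L2 l1).2 _.
      apply: measurable_funM; last first.
        exact: measurable_indic.
      by apply: measurable_edot; exact: measurable_fst.
    move=> z; rewrite normrM !ger0_norm ?edot_ge0//.
    by rewrite ler_piMr ?edot_ge0// indicE; case: (_ \in _).
  - exact: integrable_EFinD.
  move=> z _; rewrite !indicE.
  have S0 : 0 <= \sum_(j < J) B j * (z \in Z j)%:R.
    by apply: sumr_ge0 => j _; rewrite mulr_ge0.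
  have [Jz|zJ] := leqP J (idx z.1).
    rewrite (mem_set (Jz : [set x | (J <= idx x)%N] z.1)) mulr1.
    apply: (@le_trans _ _ (edot z.1 z.1)); last by rewrite lerDl.
    by rewrite ler_piMr ?edot_ge0//; case: (_ \in _).
  rewrite (memNset (A := [set x | (J <= idx x)%N])); last first.
    by apply/negP; rewrite -ltnNge.
  rewrite mulr0 add0r; have [zL|zL] := boolP (z \in [set z | L z = 0%N]);
    last first.
    by rewrite mulr0.
  rewrite mulr1; apply: (le_trans (hB z.1)).
  rewrite (bigD1 (Ordinal zJ))//= indicE mem_set; last first.
    by move: zL; rewrite inE /Z /= /L; case: ltP.
  by rewrite mulr1 lerDl; apply: sumr_ge0 => j _; rewrite mulr_ge0.
rewrite RintegralD// lerD2l Rintegral_sum; last by move=> j; exact: i3.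
apply: ler_sum => j _; rewrite RintegralZl//; last exact: integrable_indic.
by rewrite ler_wpM2l// Rintegral_indic// ZE pcj.
Qed.

(** Separability in the form of a countable partition into pieces of small diameter, not claimed to
    be measurable. The label of a measure records [J], [N] and the rounded masses of its first [J]
    cells. Two measures with the same label induce the same law of cell labels; gluing along these
    labels puts two points in one cell, unless both are discarded and contribute little to the
    second moments. *)
Lemma cost_labels (e : R) : 0 < e ->
  exists lab : P2 R D -> nat, forall mu nu, lab mu = lab nu -> cost mu nu < e.
Proof.
(* The budget is [e / 4] for pairs in a common cell and twice [e / 8] for each of the two discarded
   parts. *)
move=> e0; have e4 : 0 < e / 4 by rewrite divr_gt0.
have [idx midx idxP] := @countable_cells R D _ e4.
have [B B0 hB] := cell_bound idxP.
pose rem (mu : P2 R D) (J N : nat) : R := \int[mu]_x (edot x x * \1_[set x | (J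
  <= idx x)%N] x) +
  \sum_(j < J) B j / N.+1%:R.
have /choice[J /choice[N hJN]] : forall mu : P2 R D, exists J, exists N : nat,
    rem mu J N < e / 8.
  move=> mu; have e16 : 0 < e / 16 by rewrite divr_gt0.
  have [J hJ] := cell_tail mu midx e16; exists J.
  pose S := \sum_(j < J) B j; have S0 : 0 <= S by apply: sumr_ge0.
  exists (Num.truncn (S / (e / 16))); rewrite /rem -mulr_suml -/S.
  have /andP[_] := truncn_itv (divr_ge0 S0 (ltW e16)).
  set M := (Num.truncn _).+1%:R; rewrite ltr_pdivrMr// => SM.
  have : S / M < e / 16 by rewrite ltr_pdivrMr// mulrC.
  by move: (S / M) => SM' SMe; move: hJ; move: (\int[mu]_x _) => I hI; lra.
pose code (mu : P2 R D) := [seq Num.truncn ((N mu).+1%:R * p idx mu j) | j <-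
  iota 0 (J mu)].
exists (fun mu => pickle (J mu, N mu, code mu)) => mu nu.
move=> /(pcan_inj pickleK)[eJ eN ecode].
have ec j : c idx mu (J mu) (N mu) j = c idx nu (J nu) (N nu) j.
  move: ecode; rewrite /code /c eJ eN; case: ifP => // jJ.
  by move=> /eq_in_map/(_ j) ->//; rewrite mem_iota.
have [L1 [mL1 L1P lL1 iL1]] := cell_label mu (J mu) (N mu) midx B0 hB.
have [L2 [mL2 L2P lL2 iL2]] := cell_label nu (J nu) (N nu) midx B0 hB.
have L12 : forall j, randomized mu (L1 @^-1` [set j]) =
    randomized nu (L2 @^-1` [set j]).
  by apply: law_nat_eq => // j; rewrite [LHS]lL1 [RHS]lL2 ec.
have [Q [lQ1 lQ2 N0]] := gluing mL1 mL2 L12.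
have lX := law_comp lQ1 (product_law_fst mu lambda).
have lY := law_comp lQ2 (product_law_fst nu lambda).
pose g (L : E * I01 -> nat) (z : E * I01) : R :=
  edot z.1 z.1 * \1_[set z | L z = 0%N] z.
have g0 L z : 0 <= g L z.
  by rewrite /g mulr_ge0 ?edot_ge0// indicE; case: (_ \in _).
have gi (m : P2 R D) L : measurable_fun setT L ->
    (randomized m).-integrable setT (EFin \o g L).
  move=> mL; apply: integrable_dominated (law_L2 (product_law_fst m lambda)).2
    _.
    apply: measurable_funM.
      by apply: measurable_edot; exact: measurable_fst.
    apply: measurable_indic.
    rewrite (_ : [set z | _] = L @^-1` [set 0%N])//.
    by rewrite -[X in measurable X]setTI; exact: mL.
  move=> z; rewrite ger0_norm//.
  by rewrite ler_piMr ?edot_ge0// indicE; case: (_ \in _).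
have i1 := law_integrable lQ1 (gi mu _ mL1).
have i2 := law_integrable lQ2 (gi nu _ mL2).
apply: (le_lt_trans (cost_le lX lY)).
apply: (@le_lt_trans _ _ (\int[Q]_w (e / 4 + (2 * g L1 w.1 + 2 * g L2 w.2)))).
  apply: (le_Rintegral_negligible N0).
  - exact: law_sqdist_integrable lX lY.
  - apply: integrable_EFinD; first exact: integrable_EFin_cst.
    by apply: integrable_EFinD; exact: integrable_EFinZ.
  move=> [[x u] [y v]] /= /contrapT L12xy.
  rewrite /g !indicE; have [L0|L0] := eqVneq (L1 (x, u)) 0%N.
    rewrite !mem_set//=; last by rewrite -L12xy.
    rewrite !mulr1; apply: (@le_trans _ _ (2 * edot x x + 2 * edot y y)).
      exact: edot_normB2.
    by rewrite lerDr ltW.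
  have xy : idx x = idx y.
    case: (L1P (x, u)) => [h1|h1]; first by rewrite h1 in L0.
    case: (L2P (y, v)) => [h2|h2]; first by rewrite L12xy h2 in L0.
    by move: L12xy; rewrite h1 h2 => -[].
  apply: (le_trans (idxP _ _ xy)); rewrite lerDl addr_ge0// mulr_ge0//.
    by rewrite mulr_ge0 ?edot_ge0//; case: (_ \in _).
  by rewrite mulr_ge0 ?edot_ge0//; case: (_ \in _).
rewrite RintegralD//; [|exact: integrable_EFin_cst|]; last first.
  by apply: integrable_EFinD; exact: integrable_EFinZ.
rewrite RintegralD//; [|exact: integrable_EFinZ..].
rewrite Rintegral_probability_cst !RintegralZl//.
rewrite (law_Rintegral lQ1 (gi mu _ mL1)) (law_Rintegral lQ2 (gi nu _ mL2)).
have h1 := le_lt_trans iL1 (hJN mu); have h2 := le_lt_trans iL2 (hJN nu).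
have {}h1 : \int[randomized mu]_x g L1 x < e / 8 by exact: h1.
have {}h2 : \int[randomized nu]_x g L2 x < e / 8 by exact: h2.
lra.
Qed.

(** A Lindelof argument. A point outside the support has a ball of radius [n.+1%:R^-1] inside a null
    open set; by the choice of labels, that null set for a single member of [N n l] already contains
    all of [N n l]. *)
Lemma negligible_suppC (P : probability (wasserstein R D) R) :
  P.-negligible (~` supp P).
Proof.
have /choice[lab hlab] : forall n : nat, exists lab : P2 R D -> nat,
    forall mu nu, lab mu = lab nu -> cost mu nu < n.+1%:R^-1 ^+ 2.
  by move=> n; apply: cost_labels; rewrite exprn_gt0// invr_gt0.
pose N n l := [set mu : wasserstein R D | lab n mu = l /\
  exists U, [/\ W2_open U, P U = 0%E &
    forall nu, (W2 mu nu < n.+1%:R^-1%:E)%E -> U nu]].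
apply: (@negligibleS _ _ _ _ (\bigcup_n \bigcup_l N n l)).
  move=> mu /existsNP[U /not_implyP[oU /not_implyP[Umu PU]]].
  have [r r0 h] := oU _ Umu.
  have [n _ nr] := near_infty_natSinv_lt (PosNum r0).
  exists n => //; exists (lab n mu) => //; split => //; exists U; split => //.
    by apply/eqP; rewrite eq_le measure_ge0 andbT leNgt; apply/negP.
  move=> nu munu; apply: h; apply: (lt_trans munu); rewrite lte_fin.
  exact: (nr n (leqnn n)).
apply: negligible_bigcup => n; apply: negligible_bigcup => l.
have [[mu [mul [U [oU PU hU]]]]|N0] := pselect (exists mu, N n l mu);
  last first.
  rewrite (_ : N n l = set0); first exact: negligible_set0.
  by rewrite -subset0 => mu Nmu; apply: N0; exists mu.
apply: (@negligibleS _ (wasserstein R D) R P (U : set (wasserstein R D))).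
  move=> nu [nul _]; apply: hU; rewrite W2_ltP ?invr_gt0//.
  by apply: hlab; rewrite mul nul.
by apply/negligibleP => //; exact: measurable_W2_open.
Qed.

End separability.

(** * Potentials and the hugging inequality *)

(** The two-sided second-order estimate that combines strong convexity and smoothness, with [G] in
    the role of the gradient; the transport argument works from these inequalities alone. *)
Definition quadratic_bounds (R : realType) (D : nat) (alpha beta : R)
    (phi : 'rV[R]_D -> R) (G : 'rV[R]_D -> 'rV[R]_D) :=
  forall x y,
    phi x + edot (G x) (y - x) + alpha / 2 * edot (y - x) (y - x) <= phi y /\
    phi y <= phi x + edot (G x) (y - x) + beta / 2 * edot (y - x) (y - x).

(** Strong convexity supplies a subgradient. Smoothness keeps the difference quotients along each
    axis within [beta / 2 * |h|] of its coordinate, so every subgradient is the vector of partial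
    derivatives. *)
Lemma gradient_quadratic_bounds (R : realType) (D : nat) (alpha beta : R)
    (phi : 'rV[R]_D -> R) : 0 < beta ->
  strongly_convex alpha phi -> smooth beta phi ->
  quadratic_bounds alpha beta phi (gradient phi).
Proof.
move=> beta0 sc [_ sm].
have edot_sym (x y : 'rV[R]_D) : edot (x - y) (x - y) = edot (y - x) (y - x).
  by rewrite -opprB edotNl edotNr opprK.
have flip (g x y : 'rV[R]_D) : edot g (x - y) = - edot g (y - x).
  by rewrite -opprB edotNr.
suff gE x g : subdifferential phi x g -> gradient phi x = g.
  move=> x y; have [[g gx] scx] := sc x; rewrite (gE _ _ gx).
  have := scx _ gx y; have := sm x y _ gx.
  by rewrite !enorm_sqr edot_sym flip => ? ?; split; lra.
move=> gx; apply/rowP => i; rewrite mxE.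
apply: cvg_lim => //; apply/cvgrPdist_le => e e0.
near=> h.
have h0 : h != 0 by near: h; exact: nbhs_dnbhs_neq.
have he : `|h| <= e / beta.
  by near: h; apply: dnbhs0_le; rewrite divr_gt0.
have := gx (h *: delta_mx 0 i + x); have := sm x (h *: delta_mx 0 i + x) g gx.
rewrite flip enorm_sqr edot_sym addrK !edotE !edot_delta mxE !eqxx mulr1.
set p := phi (_ + x); move=> h1 h2.
rewrite (_ : _ *: _ = h^-1 * (p - phi x))//.
have -> : g 0 i - h^-1 * (p - phi x) = h^-1 * (h * g 0 i - (p - phi x)).
  by rewrite [RHS]mulrBr mulKf.
rewrite normrM normfV ler_pdivrMl ?normr_gt0//.
have : `|h * g 0 i - (p - phi x)| <= beta / 2 * h ^+ 2.
  by rewrite ler_norml; apply/andP; split; nra.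
move=> /le_trans; apply; rewrite -real_normK ?num_real//.
move: he; rewrite ler_pdivlMr// => he; have := normr_ge0 h.
by move: `|h| he => k kb k0; nra.
Unshelve. all: by end_near. Qed.

Section potential.
Context {R : realType} {D : nat}.
Variables (alpha beta : R) (phi : 'rV[R]_D -> R) (G : 'rV[R]_D -> 'rV[R]_D).
Hypotheses (alpha0 : 0 < alpha) (beta0 : 0 < beta).
Hypothesis qb : quadratic_bounds alpha beta phi G.

Let lower x y : phi x + edot (G x) (y - x) <= phi y.
Proof.
have [+ _] := qb x y; apply: le_trans; rewrite lerDl mulr_ge0 ?edot_ge0//.
by rewrite divr_ge0 ?ltW.
Qed.

(** Cocoercivity of the gradient: evaluating [phi] at the test point [z], from below at [x] and from
    above at [y], gives [|d|^2 <= 2 beta <d, x - y>]. The resulting constant is not sharp, but only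
    continuity of [G] is drawn from it. *)
Lemma gradient_lipschitz x y :
  edot (G x - G y) (G x - G y) <= 4 * beta ^+ 2 * edot (x - y) (x - y).
Proof.
pose d := G x - G y; pose z := y + beta^-1 *: d.
have h1 := lower x z; have [_ h2] := qb y z; have h3 := lower y x.
have dE v : edot d v = edot (G x) v - edot (G y) v by rewrite edotBl.
have h4 : edot d d <= 2 * beta * edot d (x - y).
  have bb : beta * beta^-1 = 1 by rewrite divff// gt_eqF.
  have bi0 : 0 < beta^-1 by rewrite invr_gt0.
  move: h1 h2; rewrite (_ : z - x = beta^-1 *: d - (x - y)); last first.
    by apply/rowP => i; rewrite !mxE; ring.
  rewrite (_ : z - y = beta^-1 *: d); last by rewrite /z addrC addKr.
  rewrite (edotBr (G x)) !edotZr edotZl.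
  have := dE d; have := dE (x - y); move: (edot d d) (edot d (x - y)) => dd dxy.
  move: h3 bb bi0; move: (edot (G x) _) (edot (G x) _) (edot (G y) _)
    (edot (G y) _) (phi x) (phi y) (phi z) beta^-1 => ? ? ? ? ? ? ? b h3 bb b0.
  rewrite (_ : beta / 2 * (b * (b * dd)) = (beta * b) * (b * dd) / 2);
    last by ring.
  rewrite bb => h5 h6 h1 h2.
  have h7 := congr1 (fun u => b * u) h6; rewrite /= mulrBr in h7.
  have : b * dd <= 2 * dxy by lra.
  rewrite -(ler_pM2l beta0) mulrA bb mul1r; lra.
rewrite -/d; move: h4; clear; move: d (x - y) => u v h4.
have := edot_ge0 (u - (2 * beta) *: v); rewrite !edotE (edotC v u).
by move: h4; move: (edot u u) (edot u v) (edot v v) => uu uv vv; lra.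
Qed.

Lemma gradient_inj x y : G x = G y -> x = y.
Proof.
move=> Gxy; apply/eqP; rewrite -subr_eq0; apply/eqP/edot_eq0.
have [h1 _] := qb x y; have [h2 _] := qb y x; move: h1 h2.
rewrite Gxy -(opprB x y) !edotNr !edotNl => h1 h2.
apply/le_anti; rewrite edot_ge0 andbT.
have : alpha * edot (x - y) (x - y) <= 0 by lra.
by rewrite pmulr_rle0.
Qed.

Lemma gradient_continuous : continuous G.
Proof.
move=> x A /nbhs_ballP[e /= e0 eA]; apply/nbhs_ballP.
have b0 : 0 < 4 * beta ^+ 2 by rewrite mulr_gt0// exprn_gt0.
have [r r0 hr] := @ball_edot_lt R D _ (divr_gt0 (exprn_gt0 2 e0) b0).
exists r => // y /hr; rewrite ltr_pdivlMr// mulrC => xy; apply: eA.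
apply: edot_lt_ball => //; apply: le_lt_trans xy; exact: gradient_lipschitz.
Qed.

Lemma potential_continuous : continuous phi.
Proof.
move=> x A /nbhs_ballP[e /= e0 eA]; apply/nbhs_ballP.
pose g := edot (G x) (G x) + 1.
have g0 : 0 < g by rewrite ltr_wpDl// edot_ge0.
pose s := e / g; have s0 : 0 < s by rewrite divr_gt0.
have sg : s * g = e by rewrite /s divfK// gt_eqF.
have c0 : 0 < s^-1 + beta by rewrite addr_gt0// invr_gt0.
have [r r0 hr] := @ball_edot_lt R D _ (divr_gt0 e0 c0).
exists r => // y /hr; rewrite ltr_pdivlMr// -opprB edotNl edotNr opprK => xy.
apply: eA; rewrite /ball/= /ball_ distrC.
have [_ h1] := qb x y; have h2 := lower x y.
have h3 := edot_young (G x) (y - x) s0.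
have h4 := edot_young (- G x) (y - x) s0.
rewrite !edotNl edotNr opprK in h4.
have := edot_ge0 (y - x).
move: (edot (y - x) _) (edot (G x) (y - x)) h1 h2 h3 h4 xy => v gv.
have -> : edot (G x) (G x) = g - 1 by rewrite /g addrK.
move: (phi x) (phi y) => p q h1 h2 h3 h4 h5 h6.
move: s^-1 c0 h3 h4 h5 => si c0 h3 h4 h5.
have h7 : s * (g - 1) < e by rewrite mulrBr sg mulr1 gtrBl.
have h8 : 0 <= beta * v by rewrite mulr_ge0// ltW.
rewrite ltr_norml; apply/andP; split; lra.
Qed.

(** Quadratic growth, which makes [phi] integrable against every measure of finite second moment. *)
Lemma potential_bound x : `|phi x| <=
  `|phi 0| + (edot (G 0) (G 0) + edot x x) + beta / 2 * edot x x.
Proof.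
have h1 := lower 0 x; have [_ h2] := qb 0 x; rewrite !subr0 in h1 h2.
have := edot_le_half (G 0) x; have := edot_ge0 x.
have : 0 <= beta / 2 * edot x x by rewrite mulr_ge0 ?edot_ge0// divr_ge0// ltW.
have := ler_norm (phi 0); have := ler_norm (- phi 0); rewrite normrN.
have := ler_norm (edot (G 0) x); have := ler_norm (- edot (G 0) x);
  rewrite normrN.
by move=> *; rewrite ler_norml; apply/andP; split; lra.
Qed.

End potential.

(** The space is a countable union of compact cubes, so a continuous map sends closed sets to
    countable unions of compact sets, which are Borel. The inverse [S] takes the value 0 off the
    range of [G]; the preimage of a closed set is thus its image under [G], together with the
    complement of the range when the set contains 0. *)
Lemma injective_measurable_inverse (R : realType) (D : nat)
    (G : 'rV[R]_D -> 'rV[R]_D) : continuous G -> injective G ->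
  exists2 S : euclidean R D -> euclidean R D,
    measurable_fun setT S & forall x, S (G x) = x.
Proof.
move=> cG iG; pose S (z : 'rV[R]_D) : 'rV[R]_D :=
  if pselect (exists x, G x = z) is left h then projT1 (cid h) else 0.
have SG x : S (G x) = x.
  rewrite /S; case: pselect => [h|[]]; last by exists x.
  by apply: iG; exact: projT2 (cid h).
pose cube (n : nat) := [set v : 'rV[R]_D | forall i, `[- n%:R, n%:R]%classic (v
  ord0 i)].
have ccube n : compact (cube n).
  by apply: (@rV_compact R D (fun=> `[- n%:R, n%:R]%classic)) => i;
    exact: segment_compact.
have mimage (F : set 'rV[R]_D) : closed F ->
    measurable ((G @` F) : set (euclidean R D)).
  move=> cF; rewrite (_ : G @` F = \bigcup_n (G @` (cube n `&` F))).
    apply: bigcupT_measurable => n; apply: closed_measurable_euclidean.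
    apply: compact_closed; first exact: norm_hausdorff.
    apply: continuous_compact; first exact: continuous_subspaceT.
    exact: compact_closedI.
  apply/seteqP; split => [_ [x Fx <-]|_ [n _ [x [_ Fx] <-]]]; last by exists x.
  have [n nx] : exists n : nat, edot x x <= n%:R.
    by exists (Num.truncn (edot x x)).+1; rewrite ltW// truncnS_gt.
  exists n => //; exists x => //; split => // i; rewrite /= in_itv/= -ler_norml.
  have xn := le_trans (coord_sqr_le x i) nx.
  rewrite leNgt; apply/negP => nx'; move: xn; apply/negP; rewrite -ltNge.
  rewrite -real_normK ?num_real//.
  apply: (@le_lt_trans _ _ (n%:R ^+ 2)); last by rewrite ltr_pXn2r// nnegrE.
  by rewrite -natrX ler_nat; case: (n) => // m; rewrite leq_pmulr.
exists S => //.
have Sclosed (F : set 'rV[R]_D) : closed F -> measurable (S @^-1` F : set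
  (euclidean R D)).
  move=> cF; have -> : S @^-1` F = (G @` F) `|` (if pselect (F 0) then ~` range
    G else set0).
    apply/seteqP; split => [z /=|z [[x Fx <-]|]]; last 2 first.
    - by rewrite /= SG.
    - case: pselect => //= F0 zr; rewrite /S; case: pselect => [|//] -[x xz].
      by case: zr; exists x.
    have [[x <-]|zr] := pselect (exists x, G x = z).
      by rewrite SG => Fx; left; exists x.
    rewrite {1}/S; case: pselect => // nz F0; right.
    by case: pselect => F0' // [x _ xz]; apply: zr; exists x.
  apply: measurableU; first exact: mimage.
  case: pselect => F0; last exact: (@measurable0 _ (euclidean R D)).
  exact: (@measurableC _ (euclidean R D) _ (mimage _ closedT)).
pose U : set (set (euclidean R D)) := @open 'rV[R]_D.
have mE : measurable = <<s U >> by [].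
apply: (measurability U mE) => _ [V oV <-]; rewrite setTI.
have := @measurableC _ (euclidean R D) _ (Sclosed _ (open_closedC oV)).
by rewrite -preimage_setC setCK.
Qed.

Section hugging.
Context {R : realType} {D : nat}.
Variables (alpha beta : R) (phi : 'rV[R]_D -> R) (G : 'rV[R]_D -> 'rV[R]_D).
Hypotheses (alpha0 : 0 < alpha) (beta0 : 0 < beta).
Hypothesis qb : quadratic_bounds alpha beta phi G.
Variables (mustar mu : P2 R D).
Let E := euclidean R D.
Hypothesis Gmu : has_law mustar (G : E -> E) mu.

Let phi_integrable (b : P2 R D) : b.-integrable setT (EFin \o (phi : E -> R)).
Proof.
apply: (@integrable_dominated _ _ _ b phi (fun x : E =>
  `|phi 0| + (edot (G 0) (G 0) + edot x x) + beta / 2 * edot x x)).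
- exact: (continuous_measurable_euclidean (potential_continuous alpha0 beta0
    qb)).
- have ib := P2_integrable b; apply: integrable_EFinD.
    apply: integrable_EFinD; first exact: integrable_EFin_cst.
    by apply: integrable_EFinD => //; exact: integrable_EFin_cst.
  exact: integrable_EFinZ.
- exact: (potential_bound alpha0 beta0 qb).
Qed.

Let LG : L2 mustar (G : E -> E) := law_L2 Gmu.

(* A coupling of [b] and [mu = G # mustar] lifts through the inverse of [G] to a
   coupling of [b] and [mustar]. *)
Let coupling_lift (b : P2 R D) pi : couplings b mu pi ->
  exists2 X : E * E -> E, has_law pi X mustar &
    \int[pi]_z sqdist z = \int[pi]_z sqdist (z.1, G (X z)).
Proof.
move=> /couplings_law[l1 l2].
have cG := gradient_continuous alpha0 beta0 qb.
have [S mS SG] := injective_measurable_inverse cG (gradient_inj alpha0 qb).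
have lS : has_law mu S mustar.
  split=> // A mA; rewrite -Gmu.2; first by congr (mustar _); apply/seteqP;
    split => x /=; rewrite SG.
  by rewrite -[X in measurable X]setTI; exact: mS.
have mG : measurable_fun setT (G : E -> E) := Gmu.1.
have mGS : measurable_fun setT (G \o S : E -> E) by exact: measurableT_comp.
exists (fun z => S z.2); first exact: law_comp l2 lS.
have N0 : pi.-negligible [set z | G (S z.2) <> z.2].
  pose N := [set x : E | G (S x) <> x].
  have mN : measurable N.
    have mf := measurable_edot (measurable_funB_euclidean mGS (@measurable_id _
      E setT))
      (measurable_funB_euclidean mGS (@measurable_id _ E setT)).
    rewrite (_ : N = ~` ((fun x : E => edot (G (S x) - x) (G (S x) - x)) @^-1`
      [set 0])).
      apply: measurableC; rewrite -[X in measurable X]setTI.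
      exact: mf.
    apply/seteqP; split => x /= Nx h; apply: Nx.
      by apply/eqP; rewrite -subr_eq0; apply/eqP/edot_eq0.
    by rewrite h subrr edot0l.
  have -> : [set z : E * E | G (S z.2) <> z.2] = snd @^-1` N by [].
  apply/negligibleP; first by rewrite -[X in measurable X]setTI; exact: l2.1.
  apply: (etrans (l2.2 _ mN)); apply: (etrans (esym (Gmu.2 _ mN))).
  rewrite (_ : _ @^-1` _ = set0) ?measure0//.
  by rewrite -subset0 => x /=; apply; rewrite SG.
have i1 : pi.-integrable setT (EFin \o sqdist) by exact: law_sqdist_integrable
  l1 l2.
have lGS := law_comp (law_comp l2 lS) Gmu.
have i2 : pi.-integrable setT (fun z => (sqdist (z.1, G (S z.2)))%:E).
  exact: law_sqdist_integrable l1 lGS.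
apply/le_anti/andP; split; apply: (le_Rintegral_negligible N0) => //.
- by move=> [y z] /= /contrapT ->.
- by move=> [y z] /= /contrapT ->.
Qed.

(** On the lifted coupling of [b] and [mustar], the lower quadratic bound gives [|y - G x|^2 >=
    alpha |y - x|^2 + u y + v x]. The integrals of [u] and [v] depend on the marginals only and are
    moved to [(X, Y)]. There the upper quadratic bound gives [u y + v x >= |y - G x|^2 - beta |y -
    x|^2], and expanding [y - G x] around [x] produces the remaining terms. *)
Lemma hugging d (T : measurableType d) (Q : probability T R) (X Y : T -> E)
    (b : P2 R D) : has_law Q X mustar -> has_law Q Y b ->
  \int[mustar]_x sqdist (x, G x) + alpha * cost b mustar
    + (1 - beta) * \int[Q]_w sqdist (X w, Y w)
    + 2 * \int[Q]_w edot ((X w : 'rV[R]_D) - G (X w)) ((Y w : 'rV[R]_D) - X w)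
  <= cost b mu.
Proof.
move=> lX lY; apply: cost_lb => pi cpi.
have [X' lX' ->] := coupling_lift cpi; have [lY' _] := couplings_law cpi.
pose u (y : E) := edot y y + (- 2) * phi y.
pose v (x : E) := edot (G x) (G x) + (2 * phi x + (- 2) * edot (G x) x).
have iu : b.-integrable setT (EFin \o u).
  apply: integrable_EFinD; first exact: P2_integrable.
  by apply: integrable_EFinZ; exact: phi_integrable.
have iv : mustar.-integrable setT (EFin \o v).
  apply: integrable_EFinD; first exact: LG.2.
  apply: integrable_EFinD; apply: integrable_EFinZ; first exact: phi_integrable.
  exact: L2_edot LG (P2_L2_id mustar).
have ic := law_sqdist_integrable lY' lX'.
have iuv := integrable_EFinD (law_integrable lY' iu) (law_integrable lX' iv).
apply: (@le_trans _ _ (\int[pi]_z (alpha * sqdist (z.1, X' z) + (u z.1 + v (X'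
  z))))); last first.
  apply: le_Rintegral => //.
  - by apply: integrable_EFinD => //; exact: integrable_EFinZ.
  - exact: law_sqdist_integrable lY' (law_comp lX' Gmu).
  move=> z _; have [+ _] := qb (X' z) z.1; rewrite /u /v /sqdist/=.
  move: z.1 (X' z) => y x; move: (G x) => g.
  rewrite !edotE (edotC y x) (edotC y g); lra.
rewrite RintegralD//; last exact: integrable_EFinZ.
rewrite RintegralZl// RintegralD//;
  [|exact: law_integrable lY' iu|exact: law_integrable lX' iv].
rewrite (law_Rintegral lY' iu) (law_Rintegral lX' iv).
rewrite -(law_Rintegral lY iu) -(law_Rintegral lX iv) -addrA -addrA addrCA
  lerD//.
  by rewrite ler_pM2l//; exact: cost_le.
have isq := law_sqdist_integrable lX lY.
have lG := law_comp lX Gmu.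
have LX := law_L2 lX; have LY := law_L2 lY; have LGX := law_L2 lG.
have ied := L2_edot (L2B LX LGX) (L2B LY LX).
have isG : mustar.-integrable setT (EFin \o (fun x : E => sqdist (x, G x))).
  exact: law_sqdist_integrable (has_law_id mustar) Gmu.
rewrite -(law_Rintegral lX isG) -RintegralD//;
  [|exact: law_integrable lY iu|exact: law_integrable lX iv].
rewrite -!RintegralZl// -RintegralD//; [|exact: integrable_EFinZ..].
rewrite -RintegralD//; [|exact: law_integrable lX isG|]; last first.
  by apply: integrable_EFinD; exact: integrable_EFinZ.
apply: le_Rintegral => //.
- apply: integrable_EFinD; first exact: law_integrable lX isG.
  by apply: integrable_EFinD; exact: integrable_EFinZ.
- apply: integrable_EFinD; first exact: law_integrable lY iu.
  exact: law_integrable lX iv.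
move=> w _; have [_] := qb (X w) (Y w); rewrite /u /v /sqdist/=.
move: (Y w) (X w) => y x; move: (G x) => g.
rewrite !edotE (edotC y x) (edotC x g); lra.
Qed.

Lemma cost_gradient : cost mustar mu = \int[mustar]_x sqdist (x, G x).
Proof.
apply/le_anti/andP; split; first exact: cost_le (has_law_id mustar) Gmu.
have := hugging (has_law_id mustar) (has_law_id mustar).
rewrite cost_self mulr0 addr0.
under [X in _ + _ * X + _]eq_Rintegral do rewrite /sqdist/= subrr edot0l.
under [X in _ + _ * X <= _]eq_Rintegral do rewrite subrr edotC edot0l.
by rewrite Rintegral_probability_cst !mulr0 !addr0.
Qed.

End hugging.

(** * Measures at distance zero coincide *)

Section cost_separates.
Context {R : realType} {D : nat}.
Implicit Types mu nu : P2 R D.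
Let E := euclidean R D.

Let thicken (F : set 'rV[R]_D) (r : R) : set 'rV[R]_D :=
  \bigcup_(x in F) ball x r.

Let measurable_thicken F r : measurable (thicken F r : set E).
Proof.
by apply: open_measurable_euclidean; apply: bigcup_open => x _;
  exact: ball_open.
Qed.

(** Markov's inequality in pointwise form: if [x] is in [F], then either [y] is in the
    [r]-neighbourhood of [F] or [r^-2 * |x - y|^2] is at least 1. *)
Let le_thicken mu nu (F : set 'rV[R]_D) r : cost mu nu = 0 -> closed F ->
  0 < r -> (mu (F : set E) <= nu (thicken F r : set E))%E.
Proof.
move=> c0 /closed_measurable_euclidean mF r0.
have mG := measurable_thicken F r; set G : set E := thicken F r in mG *.
rewrite -(@fineK _ (mu _)) ?fin_num_measure// -(@fineK _ (nu _))
  ?fin_num_measure//.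
rewrite lee_fin; apply/ler_addgt0Pr => e e0.
have [pi cpi] := cost_approx mu nu (mulr_gt0 e0 (exprn_gt0 2 r0)).
rewrite c0 add0r => pie; have [l1 l2] := couplings_law cpi.
have iF := integrable_indic mu mF; have iG := integrable_indic nu mG.
have isq : pi.-integrable setT (EFin \o sqdist) by exact: law_sqdist_integrable
  l1 l2.
have iFp := law_integrable l1 iF; have iGp := law_integrable l2 iG.
rewrite -!Rintegral_indic// -(law_Rintegral l1 iF) -(law_Rintegral l2 iG).
apply: (@le_trans _ _ (\int[pi]_z ((\1_G z.2 : R) + r^-2 * sqdist z))).
  apply: le_Rintegral => //.
    by apply: integrable_EFinD => //; exact: integrable_EFinZ.
  move=> [x y] _ /=; rewrite !indicE; have [xF|] := boolP (x \in _); last first.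
    move=> _; rewrite addr_ge0 ?mulr_ge0 ?sqdist_ge0 ?invr_ge0 ?exprn_ge0 ?(ltW
      r0)//.
  have [xy|xy] := ltP (sqdist (x, y)) (r ^+ 2).
    rewrite mem_set.
      by rewrite lerDl mulr_ge0 ?sqdist_ge0 ?invr_ge0 ?exprn_ge0 ?(ltW r0).
    by exists x; [exact: set_mem xF|exact: edot_lt_ball].
  apply: (@le_trans _ _ (r^-2 * sqdist (x, y))); last by rewrite lerDr.
  by rewrite -(@ler_pM2l _ (r ^+ 2)) ?exprn_gt0// mulr1 mulrA mulfV ?mul1r//
    expf_neq0// gt_eqF.
rewrite RintegralD//; last exact: integrable_EFinZ.
rewrite RintegralZl// lerD2l -(@ler_pM2l _ (r ^+ 2)) ?exprn_gt0//.
rewrite mulrA mulfV; last by rewrite expf_neq0// gt_eqF.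
by rewrite mul1r [leRHS]mulrC; exact: ltW pie.
Qed.

Let le_closed mu nu (F : set 'rV[R]_D) : cost mu nu = 0 -> closed F ->
  (mu (F : set E) <= nu (F : set E))%E.
Proof.
move=> c0 cF; pose G (n : nat) : set E := thicken F n.+1%:R^-1.
have FE : (F : set E) = \bigcap_n G n.
  apply/seteqP; split => [x Fx n _|y Gy].
    by exists x => //; apply: ballxx; rewrite invr_gt0.
  rewrite (closure_id F).1// => B /nbhs_ballP[e /= e0 eB].
  have [n _ ne] := near_infty_natSinv_lt (PosNum e0).
  have [x Fx xy] := Gy n I; exists x; split => //; apply: eB.
  apply: ball_sym; apply: le_ball xy; exact/ltW/(ne n (leqnn n)).
have cv : (nu \o G) n @[n --> \oo] --> nu (\bigcap_n G n).
  apply: nonincreasing_cvg_mu.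
  - by rewrite -ge0_fin_numE ?fin_num_measure//; exact: measurable_thicken.
  - by move=> n; exact: measurable_thicken.
  - by rewrite -FE; exact: closed_measurable_euclidean.
  - move=> m n mn; apply/subsetPset => y [x Fx xy]; exists x => //.
    by apply: le_ball xy; rewrite lef_pV2 ?posrE// ler_nat.
rewrite [in leRHS]FE -(cvg_lim _ cv)//; apply: lime_ge.
  by apply/cvg_ex; eexists; exact: cv.
by apply: nearW => n; apply: le_thicken; rewrite ?invr_gt0.
Qed.

Lemma cost0_measure_eq mu nu : cost mu nu = 0 -> measure_eq mu nu.
Proof.
move=> c0 A mA; pose G : set (set E) := @open 'rV[R]_D.
apply: (@measure_unique _ _ E G (fun=> setT)) => //.
- exact: openI.
- by move=> _; exact: openT.
- by apply/seteqP; split => // x _; exists 0%N.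
- move=> U oU; have mU : measurable U by exact: open_measurable_euclidean.
  have cU : closed (~` (U : set 'rV[R]_D)) by exact: open_closedC.
  have : mu (~` U) = nu (~` U).
    by apply/le_anti/andP; split; apply: le_closed => //; rewrite cost_sym.
  rewrite !probability_setC//.
  rewrite -(@fineK _ (mu U)) ?fin_num_measure// -(@fineK _ (nu U))
    ?fin_num_measure//.
  rewrite -!EFinB => -[] /addrI/oppr_inj h.
  transitivity (fine (mu U))%:E; first by rewrite fineK// fin_num_measure.
  by rewrite h fineK// fin_num_measure.
- by move=> _; rewrite -ge0_fin_numE// fin_num_measure.
Qed.

End cost_separates.

(** * Joint measurability and independence *)

(** A measurable choice from possibly overlapping sets: the value is one plus the least index of a
    set containing the point, and 0 when there is none. *)
Lemma measurable_first_index d (T : measurableType d) (C : nat -> set T) :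
  (forall l, measurable (C l)) -> exists L : T -> nat,
  [/\ measurable_fun setT L, forall w l, L w = l.+1 -> C l w &
      forall w, L w = 0%N -> forall l, ~ C l w].
Proof.
move=> mC.
have /choice[L hL] : forall w, exists l : nat,
    [/\ forall k, l = k.+1 -> C k w /\ (forall i, (i < k)%N -> ~ C i w) &
        l = 0%N -> forall k, ~ C k w].
  move=> w; have [[l Cl]|nC] := pselect (exists l, C l w); last first.
    by exists 0%N; split => // _ l Cl; apply: nC; exists l.
  have h : exists l, `[< C l w >] by exists l; exact/asboolP.
  exists (ex_minn h).+1; split => // k [<-].
  case: ex_minnP => m /asboolP Cm hm; split => // i im Ci.
  by have := hm i (asboolT Ci); rewrite leqNgt im.
exists L; split; last first.
- by move=> w; have [] := hL w.
- by move=> w l Lw; have [+ _] := hL w => /(_ _ Lw)[].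
apply: measurable_fun_nat => -[|j].
  rewrite (_ : _ @^-1` _ = ~` \bigcup_l C l).
    by apply: measurableC; exact: bigcupT_measurable.
  apply/seteqP; split => w /=.
    by move=> L0 [l _ Cl]; have [_ /(_ L0 l)] := hL w.
  move=> nC; case Lw : (L w) => [//|l]; exfalso; apply: nC.
  by have [/(_ _ Lw)[Cl _] _] := hL w; exists l.
rewrite (_ : _ @^-1` _ = C j `\` \bigcup_(i < j) C i).
  by apply: measurableD => //; apply: bigcup_measurable => i _.
apply/seteqP; split => w /=.
  move=> Lw; have [/(_ _ Lw)[Cj nC] _] := hL w; split => // -[i /= ij Ci].
  exact: nC ij Ci.
move=> [Cj nC]; case Lw : (L w) => [|l].
  by have [_ /(_ Lw j)] := hL w.
have [/(_ _ Lw)[Cl nCl] _] := hL w; congr S.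
have [lj|jl|//] := ltngtP l j; last by exfalso; exact: nCl jl Cj.
by exfalso; apply: nC; exists l.
Qed.

Lemma measurable_fun_index d (T : measurableType d) (R : realType)
    (L : T -> nat) (g : nat -> T -> R) : measurable_fun setT L ->
  (forall l, measurable_fun setT (g l)) ->
  measurable_fun setT (fun w => g (L w) w).
Proof.
move=> mL mg _ Y mY; rewrite setTI.
rewrite (_ : _ @^-1` Y = \bigcup_l (L @^-1` [set l] `&` g l @^-1` Y)).
  apply: bigcupT_measurable => l; apply: measurableI.
    by rewrite -[X in measurable X]setTI; exact: mL.
  by rewrite -[X in measurable X]setTI; exact: mg.
by apply/seteqP; split => [w Yw|w [l _ [/= -> //]]]; exists (L w).
Qed.

(* Caratheodory functions are jointly measurable: [f mu w] is the limit of
   [f (q mu) w] with [q] a countably valued approximation of the identity. *)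
Lemma measurable_separately (R : realType) (D : nat) d (T : measurableType d)
    (A : set (wasserstein R D)) (f : P2 R D -> T -> R) : measurable A ->
  (forall mu w e, A mu -> 0 < e -> exists2 r, 0 < r &
    forall nu, A nu -> cost mu nu < r -> `|f nu w - f mu w| < e) ->
  (forall mu w, ~ A mu -> f mu w = 0) ->
  (forall mu, measurable_fun setT (f mu)) ->
  measurable_fun setT (fun z : wasserstein R D * T => f z.1 z.2).
Proof.
move=> mA cf f0 mf.
have r0 (n : nat) : 0 < n.+1%:R^-1 :> R by rewrite invr_gt0.
have /choice[lab hlab] : forall n : nat, exists lab : P2 R D -> nat,
    forall mu nu, lab mu = lab nu -> cost mu nu < n.+1%:R^-1.
  by move=> n; exact: cost_labels.
have /choice[q hq] : forall nl : nat * nat, exists q : P2 R D,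
    (exists2 mu, A mu & lab nl.1 mu = nl.2) -> A q /\ lab nl.1 q = nl.2.
  move=> [n l]; have [[mu Amu mul]|no] :=
      pselect (exists2 mu, A mu & lab n mu = l).
    by exists mu.
  by exists point => /no.
(* The pieces of [lab n] may fail to be measurable. Each is replaced by the trace on [A] of the ball
   around its representative, and the first ball that contains [mu] is selected. *)
pose C (n l : nat) : set (wasserstein R D) :=
  [set mu | [/\ A mu, A (q (n, l)) & cost (q (n, l)) mu < n.+1%:R^-1]].
have mC n l : measurable (C n l).
  have [Aq|nAq] := pselect (A (q (n, l))); last first.
    by rewrite (_ : C n l = set0)// -subset0 => mu [].
  rewrite (_ : C n l = A `&` cost (q (n, l)) @^-1` [set x | x < n.+1%:R^-1]).
    apply: measurableI => //; rewrite -[X in measurable X]setTI.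
    apply: measurable_cost => //; rewrite -set_itvNyo; exact: measurable_itv.
  by apply/seteqP; split => mu [].
have /choice[L hL] := fun n => measurable_first_index (mC n).
pose g (n k : nat) (w : T) : R := if k is l.+1 then f (q (n, l)) w else 0.
apply: (@measurable_fun_cvg _ _ _ _
    (fun n (z : wasserstein R D * T) => g n (L n z.1) z.2)) => [n|[mu w] _].
  have [mL _ _] := hL n.
  apply: (@measurable_fun_index _ _ _ (fun z => L n z.1)
    (fun k z => g n k z.2)).
    by apply: measurableT_comp mL _; exact: measurable_fst.
  move=> [|l] /=; first exact: measurable_cst.
  exact: measurableT_comp (mf _) measurable_snd.
rewrite /=; have [Amu|nAmu] := pselect (A mu); last first.
  rewrite f0//; apply: cvg_near_cst; apply: nearW => n.
  have [_ h _] := hL n; case Ln : (L n mu) => [//|l].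
  by have [] := h _ _ Ln.
apply/cvgrPdist_lt => e e0.
have [r rpos hr] := cf mu w e Amu e0.
have [N _ hN] := near_infty_natSinv_lt (PosNum rpos).
exists N => // n /hN /= nr; rewrite distrC.
have [_ h1 h2] := hL n; case Ln : (L n mu) => [|l].
  exfalso; apply: (h2 _ Ln (lab n mu)).
  have [Aq labq] : A (q (n, lab n mu)) /\ lab n (q (n, lab n mu)) = lab n mu.
    by apply: hq; exists mu.
  by split => //; exact: hlab.
have [_ Aq cq] := h1 _ _ Ln; apply: hr => //.
by rewrite cost_sym; exact: lt_trans nr.
Qed.

Section empirical_integral.
Context d (T : measurableType d) (R : realType) (n : nat) (x : 'I_n -> T).

Lemma integral_empirical (f : T -> R) : (0 < n)%N -> measurable_fun setT f ->
  (forall y, 0 <= f y) ->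
  (\int[empirical R x]_y (f y)%:E = (n%:R^-1 * \sum_(i < n) f (x i))%:E)%E.
Proof.
move=> n0 mf f0; pose y (k : nat) := x (insubd (Ordinal n0) k).
have yE (i : 'I_n) : y i = x i by rewrite /y valKd.
have mfE : measurable_fun setT (EFin \o f) by exact/measurable_EFinP.
have fE0 t : [set: T] t -> (0 <= (f t)%:E)%E by rewrite lee_fin.
rewrite (eq_measure_integral (mscale (n%:R^-1)%:nng
    (msum (fun k => @dirac _ T (y k) R) n))); last first.
  move=> A mA _; rewrite /empirical /mscale/= /msum; congr (_ * _)%E.
  by apply: eq_bigr => i _; rewrite yE.
rewrite ge0_integral_mscale// ge0_integral_measure_sum//.
rewrite EFinM -sumEFin; congr (_ * _)%E; apply: eq_bigr => i _.
by rewrite integral_dirac// diracT mul1e yE.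
Qed.

End empirical_integral.

(** Independence on the subset [{i, j}] evaluates the joint law on rectangles, which determine the
    product measure. *)
Lemma iid_pair_law d (Omega : measurableType d) d' (T : measurableType d')
    (R : realType) (Pr : probability Omega R) (P : probability T R) (n : nat)
    (X : 'I_n -> {mfun Omega >-> T}) (i j : 'I_n) : iid Pr P X -> i != j ->
  has_law Pr (fun w => (X i w, X j w)) (P \x P)%E.
Proof.
move=> [ind lawX] ij.
have mXY : measurable_fun setT (fun w => (X i w, X j w)).
  by apply/measurable_fun_pairP; split; exact: measurable_funPT.
split=> // S mS.
have h := @product_measure_unique _ _ T T R P P
  (pushforward Pr (fun w => (X i w, X j w))).
apply/esym/h => // A B mA mB.
pose C (k : 'I_n) := if k == i then A else B.
have mC k : measurable (C k) by rewrite /C; case: ifP.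
have := ind [set i; j]%SET C mC.
rewrite big_setU1 ?inE//= big_set1.
have -> : C i = A by rewrite /C eqxx.
have -> : C j = B by rewrite /C eq_sym (negbTE ij).
have -> : Pr (X i @^-1` A) = P A by exact: (lawX i A mA).
have -> : Pr (X j @^-1` B) = P B by exact: (lawX j B mB).
move=> <-; congr (Pr _); apply/seteqP; split => w /=.
  move=> [Aw Bw] k /=; rewrite !inE /C => /orP[/eqP->|/eqP->].
    by rewrite eqxx.
  by rewrite eq_sym (negbTE ij).
move=> hw; have hi := hw i; have hj := hw j.
rewrite /= !inE !eqxx /C eqxx in hi hj; split; first exact: hi.
by have := hj (orbT _); rewrite eq_sym (negbTE ij).
Qed.

Section nonmeasurable_integrand.
Import HBNNSimple.

(* [f] need not be measurable: the integral is then a lower integral. *)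
Lemma le_integral_nonmeasurable d (T : measurableType d) (R : realType)
    (mu : {measure set T -> \bar R}) (f g : T -> \bar R) (N : set T) :
  mu.-negligible N -> measurable_fun setT g ->
  (forall w, 0 <= f w)%E -> (forall w, 0 <= g w)%E ->
  (forall w, ~ N w -> f w <= g w)%E ->
  (\int[mu]_w f w <= \int[mu]_w g w)%E.
Proof.
move=> N0 mg f0 g0 fg; rewrite ge0_integralTE//.
apply: ge_ereal_sup => _ [h /= hf <-]; rewrite -integralT_nnsfun.
apply: ae_ge0_le_integral => //.
- by move=> w _; rewrite lee_fin; exact: fun_ge0.
- by apply/measurable_EFinP; exact: measurable_funPT.
apply: negligibleS N0 => w /= nhg; apply: contrapT => nN; apply: nhg => _.
exact: le_trans (hf w) (fg w nN).
Qed.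

End nonmeasurable_integrand.

(** * Barycenters *)

Section barycenter.
Context {R : realType} {D : nat}.
Let E := euclidean R D.
Variables (P : probability (wasserstein R D) R) (mustar : P2 R D).
Variables (alpha beta : R) (T : P2 R D -> 'rV[R]_D -> 'rV[R]_D).
Hypotheses (alpha0 : 0 < alpha) (beta0 : 0 < beta).
Hypotheses (P_P2 : in_P2P2 P) (mustar_bar : is_barycenter P mustar).
Hypothesis T_supp : forall mu, supp P mu ->
  has_law mustar (T mu : E -> E) mu /\
  exists phi, quadratic_bounds alpha beta phi (T mu).
(** With the identity off the support, displacements vanish there, so that quantities depending on
    [mu] are defined everywhere and the null set outside the support contributes zero. *)
Hypothesis T_out : forall mu, ~ supp P mu -> forall x, T mu x = x.

Lemma barycenter_functionalE (nu : P2 R D) :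
  barycenter_functional P nu = (\int[P]_mu (cost nu mu)%:E)%E.
Proof. by apply: eq_integral => mu _; rewrite W2_sqr. Qed.

Lemma integrable_cost (nu : P2 R D) :
  P.-integrable setT (EFin \o (cost nu : wasserstein R D -> R)).
Proof.
apply: ge0_integrable_EFin; first exact: measurable_cost.
  by move=> mu; exact: cost_ge0.
by rewrite -barycenter_functionalE; exact: P_P2.
Qed.

Lemma barycenter_le (nu : P2 R D) :
  \int[P]_mu cost mustar mu <= \int[P]_mu cost nu mu.
Proof.
rewrite -lee_fin !EFin_Rintegral; try exact: integrable_cost.
by rewrite -!barycenter_functionalE; exact: mustar_bar.
Qed.

Definition displacement (mu : P2 R D) (x : E) : E := (x : 'rV[R]_D) - T mu x.

Lemma displacement_out mu x : ~ supp P mu -> displacement mu x = 0.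
Proof. by move=> nmu; rewrite /displacement T_out// subrr. Qed.

Lemma L2_displacement mu : L2 mustar (displacement mu).
Proof.
have [smu|nmu] := pselect (supp P mu).
  exact: L2B (P2_L2_id mustar) (law_L2 (T_supp smu).1).
rewrite (_ : displacement mu = fun=> 0); first exact: L2_cst.
by apply/funext => x; exact: displacement_out.
Qed.

Definition energy mu : R :=
  \int[mustar]_x edot (displacement mu x) (displacement mu x).

Lemma energy_supp mu : supp P mu -> energy mu = cost mustar mu.
Proof.
move=> /T_supp[lT [phi qb]]; exact/esym/(cost_gradient alpha0 beta0 qb lT).
Qed.

Lemma energy_le mu : energy mu <= cost mustar mu.
Proof.
have [smu|nmu] := pselect (supp P mu); first by rewrite energy_supp.
rewrite /energy; under eq_Rintegral do rewrite displacement_out// edot0l.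
by rewrite Rintegral_probability_cst cost_ge0.
Qed.

Section direction.
Context d (Omega : measurableType d) (Q : probability Omega R).
Variables (X H : Omega -> E).
Hypotheses (lX : has_law Q X mustar) (LH : L2 Q H).

(** For [mu] in the support, half the derivative at [t = 0] of the squared distance between [mu] and
    the law of [X + t H]. *)
Definition slope (mu : P2 R D) : R :=
  \int[Q]_w edot (displacement mu (X w)) (H w).

Let hh : R := \int[Q]_w edot (H w) (H w).

Let hh0 : 0 <= hh.
Proof. by apply: Rintegral_ge0 => w _; exact: edot_ge0. Qed.

Let L2_dispX mu : L2 Q (fun w => displacement mu (X w)).
Proof.
have [md id] := L2_displacement mu; split;
  first exact: measurableT_comp md lX.1.
exact: (law_integrable lX id).
Qed.

Let energyX mu : energy mu =
  \int[Q]_w edot (displacement mu (X w)) (displacement mu (X w)).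
Proof. by rewrite (law_Rintegral lX (L2_displacement mu).2). Qed.

Let perturbed (t : R) : exists nu : P2 R D,
  has_law Q (fun w => (X w : 'rV[R]_D) + t *: (H w : 'rV[R]_D) : E) nu.
Proof. exact: (L2_has_law (L2D (law_L2 lX) (L2Z t LH))). Qed.

Let nu t := projT1 (cid (perturbed t)).

Let lnu t : has_law Q (fun w => (X w : 'rV[R]_D) + t *: (H w : 'rV[R]_D) : E)
  (nu t).
Proof. exact: projT2 (cid (perturbed t)). Qed.

Let cost_upper t mu : supp P mu ->
  cost (nu t) mu <= energy mu + 2 * t * slope mu + t ^+ 2 * hh.
Proof.
move=> smu; have [lT _] := T_supp smu.
apply: (le_trans (cost_le (lnu t) (law_comp lX lT))).
have i1 := (L2_dispX mu).2; have i2 := L2_edot (L2_dispX mu) LH;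
  have i3 := LH.2.
rewrite energyX -!RintegralZl// -!RintegralD//.
- rewrite le_eqVlt; apply/orP; left; apply/eqP/eq_Rintegral => w _.
  rewrite /sqdist/= /displacement addrAC.
  move: ((X w : 'rV[R]_D) - T mu (X w)) (H w : 'rV[R]_D) => u v.
  by rewrite !edotE (edotC v u); ring.
- by apply: integrable_EFinD => //; exact: integrable_EFinZ.
- exact: integrable_EFinZ.
- exact: integrable_EFinZ.
Qed.

Let cost_lower t mu : supp P mu ->
  energy mu + 2 * t * slope mu + (1 - beta) * t ^+ 2 * hh <= cost (nu t) mu.
Proof.
move=> smu; have [lT [phi qb]] := T_supp smu.
apply: le_trans (hugging alpha0 beta0 qb lT lX (lnu t)).
have i2 := L2_edot (L2_dispX mu) LH; have i3 := LH.2.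
rewrite (_ : \int[Q]_w sqdist _ = t ^+ 2 * hh); last first.
  rewrite -RintegralZl//; apply: eq_Rintegral => w _.
  rewrite /sqdist/= opprD addrA subrr sub0r.
  move: (H w : 'rV[R]_D) => v; rewrite !edotE; ring.
rewrite [X in _ <= _ + 2 * X](_ : _ = t * slope mu); last first.
  rewrite -RintegralZl//; apply: eq_Rintegral => w _.
  by rewrite [X in edot _ X]addrC addKr edotZr.
rewrite -/(energy mu); have := mulr_ge0 (ltW alpha0) (cost_ge0 (nu t) mustar).
by move: (alpha * _) (energy mu) (slope mu) => a b c; lra.
Qed.

Let K : R := (1 + `|1 - beta|) * hh.

Let K0 : 0 <= K. Proof. by rewrite mulr_ge0// addr_ge0. Qed.

Let cost_slope t mu : supp P mu ->
  `|cost (nu t) mu - cost mustar mu - 2 * t * slope mu| <= t ^+ 2 * K.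
Proof.
move=> smu; have := cost_upper t smu; have := cost_lower t smu.
rewrite -(mulrA (1 - beta)) -energy_supp// /K => h1 h2.
rewrite (_ : t ^+ 2 * _ = (1 + `|1 - beta|) * (t ^+ 2 * hh)); last by ring.
have t2 : 0 <= t ^+ 2 * hh by rewrite mulr_ge0// sqr_ge0.
have h3 : 0 <= `|1 - beta| * (t ^+ 2 * hh) by rewrite mulr_ge0.
have h4 : 0 <= (`|1 - beta| + (1 - beta)) * (t ^+ 2 * hh).
  by rewrite mulr_ge0// -lerBlDr sub0r -normrN ler_norm.
move: (cost _ _) (energy _) (2 * t * _) (t ^+ 2 * hh) t2 h1 h2 h3 h4.
move=> a b c s t2 h1 h2 h3 h4; move: `|_| h3 h4 => n h3 h4.
by rewrite ler_norml; apply/andP; split; lra.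
Qed.

Lemma slope_continuous mu e : supp P mu -> 0 < e -> exists2 r, 0 < r &
  forall mu', supp P mu' -> cost mu mu' < r -> `|slope mu' - slope mu| < e.
Proof.
move=> smu e0; have K1 : 0 < 2 * (K + 1) by rewrite mulr_gt0// ltr_wpDl.
(* The time [t] is fixed so that the quadratic error [t ^+ 2 * K] stays below [t * e / 2] for all
   points of the support; the two costs are then controlled within [t * e / 2], since the difference
   quotient divides by [t]. *)
pose t := e / (2 * (K + 1)); have t0 : 0 < t by rewrite divr_gt0.
have tK : t * (K + 1) = e / 2.
  by rewrite /t; field; rewrite gt_eqF// ltr_wpDl.
have te : 0 < t * e / 2 by rewrite divr_gt0// mulr_gt0.
have [r1 r10 h1] := cost_continuous (nu t) mu te.
have [r2 r20 h2] := cost_continuous mustar mu te.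
exists (Order.min r1 r2); first by rewrite lt_min r10.
move=> mu' smu'; rewrite lt_min => /andP[/h1 {}h1 /h2 {}h2].
have := cost_slope t smu; have := cost_slope t smu'.
move: h1 h2; rewrite !(ltr_norml, ler_norml).
move: (slope mu) (slope mu') (cost _ _) (cost _ _) (cost _ _) (cost _ _).
move=> s s' a b c c' /andP[a1 a2] /andP[a3 a4] /andP[a5 a6] /andP[a7 a8].
have tKK : t ^+ 2 * K = t * (e / 2) - t ^+ 2 by rewrite -tK; ring.
have t20 : 0 < t ^+ 2 by rewrite exprn_gt0.
by apply/andP; split; rewrite -(ltr_pM2l t0); lra.
Qed.

Lemma measurable_slope : measurable_fun setT (slope : wasserstein R D -> R).
Proof.
pose t (n : nat) : R := n.+1%:R^-1.
pose f (n : nat) (mu : wasserstein R D) : R :=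
  \1_(supp P) mu * ((cost (nu (t n)) mu - cost mustar mu) * (2^-1 * n.+1%:R)).
apply: (@measurable_fun_cvg _ _ _ _ f) => [n|mu _].
  apply: measurable_funM; first by apply: measurable_indic;
    exact: supp_measurable.
  apply: measurable_funM; last exact: measurable_cst.
  by apply: measurable_funB; exact: measurable_cost.
have [smu|nmu] := pselect (supp P mu); last first.
  rewrite (_ : slope mu = 0); last first.
    rewrite /slope; under eq_Rintegral do rewrite displacement_out// edot0l.
    exact: Rintegral_probability_cst.
  apply: cvg_near_cst; apply: nearW => n.
  by rewrite /f indicE memNset ?mul0r.
apply/cvgrPdist_le => e e0.
have K1 : 0 < K + 1 by rewrite ltr_wpDl.
have [N _ hN] := near_infty_natSinv_lt (PosNum (divr_gt0 e0 K1)).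
exists N => // n /hN /=; rewrite -/(t n) ltr_pdivlMr// => tn.
have t0 : 0 < t n by rewrite invr_gt0.
have nt : n.+1%:R * t n = 1 by rewrite mulfV.
rewrite /f indicE mem_set// mul1r; have := cost_slope (t n) smu.
move: (cost _ _ - _) (slope mu) => a s.
move=> h; move: (n.+1%:R : R) (ler0n R n.+1) (t n) t0 nt tn h.
move=> m m0 t' t'0 nt tn h.
have -> : s - a * (2^-1 * m) = - (m / 2) * (a - 2 * t' * s).
  have e1 : s = m * t' * s by rewrite nt mul1r.
  by rewrite {1}e1; field.
rewrite normrM normrN (ger0_norm (divr_ge0 m0 (ler0n R 2))).
apply: (@le_trans _ _ (m / 2 * (t' ^+ 2 * K)));
  first by rewrite ler_wpM2l// divr_ge0.
have -> : m / 2 * (t' ^+ 2 * K) = (m * t') * (t' * K) / 2 by field.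
rewrite nt mul1r; have := mulr_ge0 (ltW t'0) K0; move: tn; rewrite mulrDr mulr1.
move: (t' * K) => u; lra.
Qed.

Lemma slope_le mu : `|slope mu| <= cost mustar mu + hh.
Proof.
have i1 := (L2_dispX mu).2; have i2 := L2_edot (L2_dispX mu) LH;
  have i3 := LH.2.
apply: (le_trans (le_normr_Rintegral measurableT i2)).
apply: (@le_trans _ _ (energy mu + hh)); last by rewrite lerD2r energy_le.
rewrite energyX -RintegralD//; apply: le_Rintegral => //.
- exact: integrable_norm i2.
- exact: integrable_EFinD.
- by move=> w _; exact: edot_le_half.
Qed.

Lemma integrable_slope : P.-integrable setT (EFin \o (slope : wasserstein R D ->
  R)).
Proof.
apply: (integrable_dominated measurable_slope
  (integrable_EFinD (integrable_cost mustar) (integrable_EFin_cst P hh))).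
exact: slope_le.
Qed.

(* First-order optimality of [mustar] along the curve [t |-> law (X + t H)]. *)
Lemma slope_expectation_ge0 : 0 <= \int[P]_mu slope mu.
Proof.
have ic := integrable_cost mustar; have isl := integrable_slope.
have key t : 0 < t -> 0 <= 2 * t * \int[P]_mu slope mu + t ^+ 2 * hh.
  move=> t0; have := barycenter_le (nu t).
  suff : \int[P]_mu cost (nu t) mu <=
      \int[P]_mu cost mustar mu + (2 * t * \int[P]_mu slope mu + t ^+ 2 * hh).
    by move=> /[swap] /le_trans /[apply]; rewrite lerDl.
  have -> : t ^+ 2 * hh = \int[P]_mu (t ^+ 2 * hh).
    by rewrite Rintegral_probability_cst.
  have i1 := integrable_EFinZ (2 * t) isl.
  have i2 := integrable_EFin_cst P (t ^+ 2 * hh).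
  rewrite -(RintegralZl _ _ isl)// -RintegralD// -RintegralD//; last first.
    exact: integrable_EFinD.
  apply: (le_Rintegral_negligible (negligible_suppC P)).
  - exact: integrable_cost.
  - by apply: integrable_EFinD => //; exact: integrable_EFinD.
  move=> mu /contrapT smu; rewrite addrA -energy_supp//; exact: cost_upper.
rewrite leNgt; apply/negP => I0.
have h1 : 0 < hh + 1 by rewrite ltr_wpDl.
(* At this [t] the supposedly nonnegative quantity equals [- t ^+ 2 * hh - 2 * t ^+ 2]; the [+ 1]
   keeps the denominator positive when [hh] vanishes. *)
set I := \int[P]_mu _ in key I0; pose t := - I / (hh + 1).
have t0 : 0 < t by rewrite divr_gt0// oppr_gt0.
have := key _ t0; apply/negP; rewrite -ltNge.
have tI : I = - t * (hh + 1) by rewrite mulNr /t divfK ?opprK// gt_eqF.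
have t20 : 0 < t ^+ 2 by rewrite exprn_gt0.
have th : 0 <= t ^+ 2 * hh by rewrite mulr_ge0// ltW.
rewrite tI (_ : _ + _ = - (t ^+ 2 * hh) - 2 * t ^+ 2); last by ring.
by rewrite -opprD oppr_lt0 ltr_wpDl// mulr_gt0.
Qed.

End direction.

Lemma cost_hugging d (Omega : measurableType d) (Q : probability Omega R)
    (X Y : Omega -> E) (b mu : P2 R D) :
  has_law Q X mustar -> has_law Q Y b -> supp P mu ->
  alpha * cost b mustar + (1 - beta) * \int[Q]_w sqdist (X w, Y w)
    + 2 * slope Q X (fun w => (Y w : 'rV[R]_D) - X w) mu
  <= cost b mu - cost mustar mu.
Proof.
move=> lX lY smu; have [lT [phi qb]] := T_supp smu.
have h : energy mu + alpha * cost b mustar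
    + (1 - beta) * \int[Q]_w sqdist (X w, Y w)
    + 2 * slope Q X (fun w => (Y w : 'rV[R]_D) - X w) mu <= cost b mu.
  exact: (hugging alpha0 beta0 qb lT lX lY).
by rewrite lerBrDl -(energy_supp smu) !addrA.
Qed.

(** The sign of [1 - beta] is unknown. If it is nonnegative, minimality of [cost] gives the bound;
    if it is negative, near optimality does, at the price [|1 - beta| * e]. *)
Lemma near_optimal_coupling (b : P2 R D) (e : R) : 0 < e ->
  exists2 pi, couplings mustar b pi &
    (1 - beta) * cost b mustar - `|1 - beta| * e <=
    (1 - beta) * \int[pi]_z sqdist z /\
    \int[pi]_z sqdist z <= cost b mustar + e.
Proof.
move=> e0; have [pi cpi] := cost_approx mustar b e0; rewrite cost_sym => hI.
exists pi => //; split; last exact: ltW.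
have [l1 l2] := couplings_law cpi; have := cost_le l1 l2; rewrite cost_sym.
have -> : \int[pi]_w sqdist (w.1, w.2) = \int[pi]_z sqdist z by [].
move: hI; move: (\int[pi]_z _) (cost b mustar) (1 - beta) => I c k hI cI.
have [k0|k0] := leP 0 k; rewrite ?(ger0_norm k0) ?(ltr0_norm k0); nra.
Qed.

Hypothesis alpha_beta : 0 < 1 - beta + alpha.

Lemma unique_barycenter (b : P2 R D) : is_barycenter P b -> measure_eq b mustar.
Proof.
move=> bar_b; apply: cost0_measure_eq; apply/le_anti; rewrite cost_ge0 andbT.
have hb : \int[P]_mu cost b mu <= \int[P]_mu cost mustar mu.
  rewrite -lee_fin !EFin_Rintegral; try exact: integrable_cost.
  by rewrite -!barycenter_functionalE; exact: bar_b.
suff key e : 0 < e -> (1 - beta + alpha) * cost b mustar <= `|1 - beta| * e.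
  rewrite -(pmulr_rle0 _ alpha_beta); apply/ler_addgt0Pr => e e0.
  have n0 : 0 < `|1 - beta| + 1 by rewrite ltr_wpDl.
  apply: (le_trans (key _ (divr_gt0 e0 n0)));
    rewrite add0r mulrCA ler_piMr ?(ltW e0)//.
  by rewrite ler_pdivrMr// mul1r lerDl.
move=> e0; have [pi cpi [hI _]] := near_optimal_coupling b e0.
have [l1 l2] := couplings_law cpi.
pose H (w : E * E) : E := (w.2 : 'rV[R]_D) - w.1.
have LH : L2 pi H := L2B (law_L2 l2) (law_L2 l1).
have is0 := integrable_slope l1 LH; have s0 := slope_expectation_ge0 l1 LH.
pose C : R := alpha * cost b mustar + (1 - beta) * \int[pi]_z sqdist z.
have : C + 2 * \int[P]_mu slope pi fst H mu <=
    \int[P]_mu cost b mu - \int[P]_mu cost mustar mu.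
  rewrite -RintegralB//; try exact: integrable_cost.
  rewrite -[X in X + _](Rintegral_probability_cst P) -RintegralZl//.
  rewrite -RintegralD//; [|exact: integrable_EFin_cst|exact: integrable_EFinZ].
  apply: (le_Rintegral_negligible (negligible_suppC P)).
  - apply: integrable_EFinD; first exact: integrable_EFin_cst.
    exact: integrable_EFinZ.
  - have := integrableB measurableT (integrable_cost b) (integrable_cost
      mustar).
    by apply.
  by move=> mu /contrapT smu; exact: cost_hugging.
move=> h4; have h5 : C <= 0.
  apply: (@le_trans _ _ (\int[P]_mu cost b mu - \int[P]_mu cost mustar mu)).
    by apply: le_trans h4; rewrite lerDl mulr_ge0.
  by rewrite subr_le0.
by move: h5 hI; rewrite /C; move: (\int[pi]_z _) => I; lra.
Qed.

(** The inner product of two displacements in L^2([mustar]). Written as a slope, it inherits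
    continuity, measurability and the sign of the expectation in its first argument. *)
Definition cross (mu mu' : P2 R D) : R :=
  slope mustar (fun x => x) (displacement mu') mu.

Lemma crossE mu mu' : cross mu mu' =
  \int[mustar]_x edot (displacement mu x) (displacement mu' x).
Proof. by []. Qed.

Lemma cross_sym mu mu' : cross mu mu' = cross mu' mu.
Proof. by rewrite !crossE; apply: eq_Rintegral => x _; rewrite edotC. Qed.

Lemma cross_le mu mu' : `|cross mu mu'| <= cost mustar mu + cost mustar mu'.
Proof.
apply: (le_trans (slope_le (has_law_id mustar) (L2_displacement mu') mu)).
by rewrite lerD2l; exact: energy_le.
Qed.

Lemma cross_out mu mu' : ~ supp P mu -> cross mu mu' = 0.
Proof.
move=> nmu; rewrite crossE.
under eq_Rintegral do rewrite displacement_out// edot0l.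
exact: Rintegral_probability_cst.
Qed.

Lemma cross_expectation mu' : \int[P]_mu cross mu mu' = 0.
Proof.
have L := L2_displacement mu'; have l := has_law_id mustar.
apply/le_anti/andP; split; last exact: slope_expectation_ge0 l L.
have := slope_expectation_ge0 l (L2Z (-1) L).
have -> : \int[P]_mu slope mustar (fun x => x)
    (fun w : E => -1 *: (displacement mu' w : 'rV[R]_D)) mu =
    \int[P]_mu (-1 * cross mu mu').
  apply: eq_Rintegral => mu _; rewrite crossE -RintegralZl//.
    by apply: eq_Rintegral => x _; rewrite edotZr.
  exact: L2_edot (L2_displacement mu) L.
rewrite RintegralZl// ?mulN1r ?oppr_ge0//.
exact: integrable_slope l L.
Qed.

Lemma cross_sum n (x : 'I_n -> P2 R D) :
  \int[mustar]_y edot (\sum_(i < n) (displacement (x i) y : 'rV[R]_D))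
                     (\sum_(i < n) (displacement (x i) y : 'rV[R]_D)) =
  \sum_(i < n) \sum_(j < n) cross (x i) (x j).
Proof.
have LS : L2 mustar (fun y => \sum_(i < n) (displacement (x i) y : 'rV[R]_D)).
  by apply: L2_sum => i; exact: L2_displacement.
under eq_Rintegral do rewrite edot_suml.
rewrite Rintegral_sum => [|i]; last exact: L2_edot (L2_displacement _) LS.
apply: eq_bigr => i _; under eq_Rintegral do rewrite edot_sumr.
by rewrite Rintegral_sum => // j; apply: L2_edot; exact: L2_displacement.
Qed.

Lemma cross_sum_ge0 n (x : 'I_n -> P2 R D) :
  0 <= \sum_(i < n) \sum_(j < n) cross (x i) (x j).
Proof. by rewrite -cross_sum; apply: Rintegral_ge0 => y _; exact: edot_ge0. Qed.

Lemma cost_empirical_barycenter n (x : 'I_n -> P2 R D) (b : P2 R D) :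
  (0 < n)%N -> (forall i, supp P (x i)) ->
  \sum_(i < n) cost b (x i) <= \sum_(i < n) cost mustar (x i) ->
  cost b mustar <= 4 / ((1 - beta + alpha) ^+ 2 * n%:R ^+ 2) *
    \sum_(i < n) \sum_(j < n) cross (x i) (x j).
Proof.
move=> n0 sx bx; set k := 1 - beta + alpha; set N : R := n%:R.
set c := cost b mustar; set Z := \sum_(i < n) _.
have N0 : 0 < N by rewrite ltr0n.
(* The optimal weight in Young's inequality: the cross term consumes half of the coercive term
   [N * k * c], and the square of [s^-1] is the constant of the statement. *)
pose s := k * N / 2; have s0 : 0 < s by rewrite divr_gt0// mulr_gt0.
have r0 : 0 < s^-1 by rewrite invr_gt0.
have -> : 4 / (k ^+ 2 * N ^+ 2) = s^-1 ^+ 2.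
  by rewrite /s; field; rewrite !gt_eqF.
(* [M * e] is the total error of near optimality, [(s + N * |1 - beta|) * e], after division by
   [s]. *)
pose M := 1 + s^-1 * (N * `|1 - beta|).
have M0 : 0 < M by rewrite ltr_pwDl// mulr_ge0 ?(ltW r0)// mulr_ge0 ?(ltW N0).
suff key e : 0 < e -> c <= s^-1 ^+ 2 * Z + M * e.
  apply/ler_addgt0Pr => e e0; apply: (le_trans (key _ (divr_gt0 e0 M0))).
  by rewrite mulrCA mulfV ?mulr1// gt_eqF.
move=> e0; have [pi cpi [hI Ic]] := near_optimal_coupling b e0.
have [l1 l2] := couplings_law cpi.
pose H (w : E * E) : E := (w.2 : 'rV[R]_D) - w.1.
have LH : L2 pi H := L2B (law_L2 l2) (law_L2 l1).
pose S (y : E) : E := \sum_(i < n) (displacement (x i) y : 'rV[R]_D).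
have LS0 : L2 mustar S by apply: L2_sum => i; exact: L2_displacement.
have LS : L2 pi (fun w => S w.1).
  by split; [exact: measurableT_comp LS0.1 l1.1|exact: law_integrable l1 LS0.2].
have LD i : L2 pi (fun w => displacement (x i) w.1).
  have [md id] := L2_displacement (x i).
  by split; [exact: measurableT_comp md l1.1|exact: law_integrable l1 id].
have SZ : \int[pi]_w edot (S w.1) (S w.1) = Z.
  by rewrite (law_Rintegral l1 LS0.2); exact: cross_sum.
have SH : \sum_(i < n) slope pi fst H (x i) = \int[pi]_w edot (S w.1) (H w).
  under [RHS]eq_Rintegral do rewrite edot_suml.
  by rewrite Rintegral_sum => // i; exact: L2_edot (LD i) LH.
pose I := \int[pi]_z sqdist z; pose C : R := alpha * c + (1 - beta) * I.
have h1 : N * C + 2 * \int[pi]_w edot (S w.1) (H w) <= 0.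
  rewrite -SH mulr_sumr (_ : N * C = \sum_(i < n) C); last first.
    by rewrite sumr_const card_ord mulr_natl.
  rewrite -big_split/=.
  apply: (@le_trans _ _ (\sum_(i < n) (cost b (x i) - cost mustar (x i)))).
    by apply: ler_sum => i _; exact: cost_hugging.
  by rewrite sumrB subr_le0.
have h2 : - (2 * \int[pi]_w edot (S w.1) (H w)) <= s * I + s^-1 * Z.
  have iI : pi.-integrable setT (EFin \o sqdist) by exact: law_sqdist_integrable
    l1 l2.
  have iSH := L2_edot LS LH.
  rewrite -SZ -mulNr -!RintegralZl//; last exact: LS.2.
  rewrite -RintegralD//; [|exact: integrable_EFinZ|]; last first.
    exact: (integrable_EFinZ _ LS.2).
  apply: le_Rintegral => //; first exact: integrable_EFinZ.
    by apply: integrable_EFinD; [|apply: (integrable_EFinZ _ LS.2)];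
      exact: integrable_EFinZ.
  move=> w _; have -> : sqdist w = edot (H w) (H w).
    by rewrite /sqdist /H -opprB edotNl edotNr opprK.
  have := edot_young (H w) (- (S w.1 : 'rV[R]_D)) s0.
  by rewrite !edotNr edotNl opprK (edotC (H w)) mulrN mulNr.
have h3 : s * 2 = N * k by rewrite /s; field.
have h4 : s * c <= s^-1 * Z + (s + N * `|1 - beta|) * e.
  have h5 : N * ((1 - beta) * c - `|1 - beta| * e) <= N * ((1 - beta) * I).
    by rewrite ler_pM2l.
  have h6 : s * I <= s * (c + e) by rewrite ler_pM2l.
  move: h1 h2; rewrite /C.
  have : s * 2 * c = N * k * c by rewrite h3.
  rewrite /k; move: (\int[pi]_w _) (s^-1 * Z) => A B; lra.
rewrite -(ler_pM2l s0) (le_trans h4)// mulrDr.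
rewrite expr2 -mulrA (mulrA s s^-1) mulfV ?gt_eqF// mul1r lerD2l.
by rewrite mulrA ler_pM2r// /M mulrDr mulr1 mulrA mulfV ?gt_eqF// mul1r.
Qed.

Let c := cross.

(** Joint measurability serves Fubini for pairs of distinct samples and the restriction to the
    diagonal for equal ones. Continuity on the support in the first argument comes from the slope,
    measurability in the second from symmetry. *)
Let measurable_c : measurable_fun setT
  (fun z : wasserstein R D * wasserstein R D => c z.1 z.2).
Proof.
have L mu := L2_displacement mu.
apply: (@measurable_separately _ _ _ _ (supp P)).
- exact: supp_measurable.
- move=> mu mu' e smu e0.
  exact: (slope_continuous (has_law_id mustar) (L mu') smu e0).
- by move=> mu mu' nmu; exact: cross_out.
- move=> mu; rewrite (_ : c mu = fun mu' => c mu' mu); last first.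
    by apply/funext => mu'; exact: cross_sym.
  exact: (measurable_slope (has_law_id mustar) (L mu)).
Qed.

Let c_le mu mu' : `|c mu mu'| <= cost mustar mu + cost mustar mu'.
Proof. exact: cross_le. Qed.

Let integrable_c : (P \x P)%E.-integrable setT
  (fun z : wasserstein R D * wasserstein R D => (c z.1 z.2)%:E).
Proof.
pose Q : probability (wasserstein R D * wasserstein R D)%type R := (P \x P)%E.
have i := integrable_cost mustar.
have i1 := law_integrable (product_law_fst P P) i.
have i2 := law_integrable (product_law_snd P P) i.
apply: (@integrable_dominated _ _ _ Q _
  (fun z => cost mustar z.1 + cost mustar z.2)) => //.
exact: integrable_EFinD i1 i2.
Qed.

Let c_expectation :
  \int[(P \x P)%E]_(z in [set: wasserstein R D * wasserstein R D]) c z.1 z.2 =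
    0.
Proof.
rewrite /Rintegral -(integral12_prod_meas1 integrable_c).
rewrite (eq_integral (fun=> 0%E)) ?integral0// => mu _.
rewrite /fubini_F/=.
have h : P.-integrable setT (fun mu' : wasserstein R D => (c mu' mu)%:E).
  exact: (integrable_slope (has_law_id mustar) (L2_displacement mu)).
under eq_integral do rewrite /c cross_sym.
rewrite -(EFin_Rintegral h) /c.
by rewrite cross_expectation.
Qed.

(** In expectation the double sum of [cross] keeps its [n] diagonal terms, each at most the
    variance; off the diagonal, independent centred displacements are orthogonal. Dividing by the
    [n ^+ 2] of the deterministic bound leaves the rate [n^-1]. *)
Lemma empirical_barycenter_bound (n : nat) d (Omega : measurableType d)
    (Pr : probability Omega R) (X : 'I_n -> {mfun Omega >-> wasserstein R D})
    (mun : Omega -> P2 R D) :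
  (0 < n)%N -> iid Pr P X ->
  (forall w, is_barycenter (empirical R (fun i => X i w)) (mun w)) ->
  (\int[Pr]_w (W2 (mun w) mustar ^+ 2) <=
   (4 / ((1 - beta + alpha) ^+ 2 * n%:R))%:E * barycenter_functional P
     mustar)%E.
Proof.
move=> n0 iidX bar_mun; set k := 1 - beta + alpha.
have lX i : has_law Pr (X i) P.
  by split; [exact: measurable_funPT|move=> A mA; exact: (iidX.2 i A mA)].
(* The event that some sample falls outside the support, written as a countable union in which
   indices beyond [n] give the empty set. *)
pose N := \bigcup_m oapp (fun i => X i @^-1` (~` supp P)) set0 (insub m : option
  'I_n).
have N0 : Pr.-negligible N.
  apply: negligible_bigcup => m; case: insub => [i|] /=;
    last exact: negligible_set0.
  have mS : measurable (~` supp P : set (wasserstein R D)).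
    by apply: measurableC; exact: supp_measurable.
  apply/negligibleP; first by rewrite -[X in measurable X]setTI;
    exact: (lX i).1.
  apply: (etrans ((lX i).2 _ mS)).
  by apply/negligibleP => //; exact: negligible_suppC.
pose S w := \sum_(i < n) \sum_(j < n) c (X i w) (X j w).
pose K : R := 4 / (k ^+ 2 * n%:R ^+ 2).
have K0 : 0 <= K by rewrite divr_ge0// mulr_ge0 ?exprn_ge0// ltW.
have bound w : ~ N w -> cost (mun w) mustar <= K * S w.
  move=> nNw; apply: (cost_empirical_barycenter n0).
  - by move=> i; apply: contrapT => ns; apply: nNw; exists i => //;
      rewrite valK.
  have := bar_mun w mustar; rewrite /barycenter_functional.
  under eq_integral do rewrite W2_sqr.
  under [X in (_ <= X)%E -> _]eq_integral do rewrite W2_sqr.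
  rewrite !integral_empirical//; try (by move=> ?; exact: cost_ge0);
    try exact: measurable_cost.
  by rewrite lee_fin ler_pM2l// invr_gt0 ltr0n.
have ic : P.-integrable setT (EFin \o (fun mu : wasserstein R D => c mu mu)).
  have i := integrable_cost mustar.
  have mdiag : measurable_fun setT (fun mu : wasserstein R D => (mu, mu)).
    by apply/measurable_fun_pairP; split; exact: measurable_id.
  apply: (@integrable_dominated _ _ _ P (fun mu => c mu mu)
    (fun mu => cost mustar mu + cost mustar mu)).
  - exact: (measurableT_comp measurable_c mdiag).
  - exact: (integrable_EFinD i i).
  - by move=> mu; exact: c_le.
have icX i j : Pr.-integrable setT (fun w => (c (X i w) (X j w))%:E).
  have [<-|ij] := eqVneq i j; first exact: law_integrable (lX i) ic.
  exact: (law_integrable (iid_pair_law iidX ij) integrable_c).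
have EcX i j : \int[Pr]_w c (X i w) (X j w) =
    if i == j then \int[P]_mu c mu mu else 0.
  have [<-|ij] := eqVneq i j; first exact: law_Rintegral (lX i) ic.
  by rewrite (law_Rintegral (iid_pair_law iidX ij) integrable_c).
have iS : Pr.-integrable setT (fun w => (S w)%:E).
  by apply: integrable_EFin_sum => i; exact: integrable_EFin_sum.
have ES : \int[Pr]_w S w <= n%:R * \int[P]_mu cost mustar mu.
  rewrite Rintegral_sum; last by move=> i; exact: integrable_EFin_sum.
  rewrite mulr_natl -[n in leRHS]card_ord -sumr_const.
  apply: ler_sum => i _; rewrite Rintegral_sum// (bigD1 i)//= EcX eqxx.
  rewrite big1 ?addr0 => [|j ji]; last by rewrite EcX eq_sym (negbTE ji).
  apply: le_Rintegral => //; first exact: integrable_cost.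
  by move=> mu _; exact: energy_le.
(* The squared distance from [mun w] may be nonmeasurable in [w], while its majorant [K * S w] is
   measurable and nonnegative everywhere. *)
apply: (@le_trans _ _ (\int[Pr]_w (K * S w)%:E)%E).
  apply: (le_integral_nonmeasurable N0).
  - by apply/measurable_EFinP/measurable_funM => //;
      case/integrableP : iS => /measurable_EFinP.
  - by move=> w; rewrite W2_sqr lee_fin cost_ge0.
  - by move=> w; rewrite lee_fin mulr_ge0//; exact: cross_sum_ge0.
  - by move=> w nNw; rewrite W2_sqr lee_fin bound.
have -> : (\int[Pr]_w (K * S w)%:E = (K * \int[Pr]_w S w)%:E)%E.
  rewrite -EFin_Rintegral; last exact: integrable_EFinZ.
  by rewrite RintegralZl.
rewrite barycenter_functionalE -(EFin_Rintegral (integrable_cost mustar)).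
rewrite -EFinM lee_fin.
apply: (le_trans (ler_wpM2l K0 ES)); rewrite mulrA ler_wpM2r//.
  by apply: Rintegral_ge0 => mu _; exact: cost_ge0.
rewrite /K le_eqVlt; apply/orP; left; apply/eqP; field.
by rewrite !gt_eqF ?ltr0n.
Qed.

End barycenter.

Theorem corollary2 (R : realType) (D : nat)
  (P : probability (wasserstein R D) R) (mustar : P2 R D) (sigma2 : \bar R)
  (alpha beta : R) :
  in_P2P2 P ->
  is_barycenter P mustar ->
  sigma2 = barycenter_functional P mustar ->
  0 < alpha -> 0 < beta ->
  (forall mu : P2 R D, supp P mu ->
    exists phi : 'rV[R]_D -> R,
      [/\ strongly_convex alpha phi, smooth beta phi &
          forall A : set (euclidean R D), measurable A ->
            mu A = pushforward mustar
                     (gradient phi : euclidean R D -> euclidean R D) A]) ->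
  beta - alpha < 1 ->
  (forall nu : P2 R D, is_barycenter P nu -> measure_eq nu mustar) /\
  (forall (n : nat) (d : measure_display) (Omega : measurableType d)
     (Pr : probability Omega R) (X : 'I_n -> {mfun Omega >-> wasserstein R D})
     (mun : Omega -> P2 R D),
     (1 <= n)%N ->
     iid Pr P X ->
     (forall w, is_barycenter (empirical R (fun i => X i w)) (mun w)) ->
     (\int[Pr]_w (W2 (mun w) mustar ^+ 2) <=
      (4 / ((1 - beta + alpha) ^+ 2 * n%:R))%:E * sigma2)%E).
Proof.
move=> P_P2 mustar_bar -> alpha0 beta0 potentials beta_alpha.
have alpha_beta : 0 < 1 - beta + alpha by lra.
have /choice[phi phiP] : forall mu : P2 R D, exists phi : 'rV[R]_D -> R,
    supp P mu -> has_law mustar (gradient phi : euclidean R D -> euclidean R D)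
      mu /\
      quadratic_bounds alpha beta phi (gradient phi).
  move=> mu; have [smu|nmu] := pselect (supp P mu); last by exists (fun=> 0).
  have [phi [sc sm muE]] := potentials mu smu; exists phi => _.
  have qb := gradient_quadratic_bounds beta0 sc sm; split => //.
  split=> [|A mA]; last exact/esym/muE.
  exact: (continuous_measurable_map (gradient_continuous alpha0 beta0 qb)).
(* Off the support the chosen potential is arbitrary, so the transport map is reset to the identity
   there. *)
pose T (mu : P2 R D) (x : 'rV[R]_D) : 'rV[R]_D :=
  if `[< supp P mu >] then gradient (phi mu) x else x.
have T_supp mu : supp P mu ->
    has_law mustar (T mu : euclidean R D -> euclidean R D) mu /\
    exists psi, quadratic_bounds alpha beta psi (T mu).
  move=> smu; have -> : T mu = gradient (phi mu).
    by apply/funext => x; rewrite /T asboolT.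
  by have [lphi qb] := phiP mu smu; split => //; exists (phi mu).
have T_out mu : ~ supp P mu -> forall x, T mu x = x.
  by move=> nmu x; rewrite /T asboolF.
split=> [nu|n d Omega Pr X mun n0 iidX mun_bar].
  exact: (unique_barycenter alpha0 beta0 P_P2 mustar_bar T_supp T_out
    alpha_beta).
exact: (empirical_barycenter_bound alpha0 beta0 P_P2 mustar_bar T_supp T_out
  alpha_beta n0 iidX mun_bar).
Qed.
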